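(* $\mathfrak{M}_L^U(\mathbb{R}^d)\subsetneqq\mathfrak{R}(\mathcal{A}_1)=\mathfrak{R}(\mathcal{A}_2)$, where $\mathfrak{R}(\mathcal{A}_k)=\{\mathcal{A}_k(\nu):\nu\in\mathfrak{M}_L^k(\mathbb{R}^d)\}$.
   Context: A Lévy measure on $\mathbb{R}^d$ is a measure $\nu$ with $\nu(\{0\})=0$ and $\int(1\wedge|x|^2)\nu(\mathrm{d}x)<\infty$; their class is $\mathfrak{M}_L(\mathbb{R}^d)=\mathfrak{M}_L^2(\mathbb{R}^d)$, and $\mathfrak{M}_L^1(\mathbb{R}^d)$ is the class of Lévy measures with $\int(1\wedge|x|)\nu(\mathrm{d}x)<\infty$. For $s>0$ set $a_1(r;s)=2\pi^{-1}(s-r^2)^{-1/2}$ for $0<r<s^{1/2}$ and $0$ otherwise; $a_2(r;s)=2\pi^{-1}(s^2-r^2)^{-1/2}$ for $0<r<s$ and $0$ otherwise. $\mathcal{A}_k(\nu)(B)=\int_{\mathbb{R}^d\setminus\{0\}}\nu(\mathrm{d}x)\int_0^\infty a_k(r;|x|)1_B(rx/|x|)\,\mathrm{d}r$. A polar decomposition of $\nu\in\mathfrak{M}_L(\mathbb{R}^d)$ is a pair $(\lambda,\{\nu_\xi\})$, $\lambda$ a measure on the unit sphere $\mathbb{S}$, $\nu_\xi$ measures on $(0,\infty)$ with $\nu_\xi(E)$ measurable in $\xi$, $0<\nu_\xi((0,\infty))\le\infty$, and $\nu(B)=\int_{\mathbb{S}}\lambda(\mathrm{d}\xi)\int_0^\infty1_B(r\xi)\nu_\xi(\mathrm{d}r)$.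 $\mathfrak{M}_L^U(\mathbb{R}^d)$ (Lévy measures of the Jurek class) is the class of $\nu\in\mathfrak{M}_L(\mathbb{R}^d)$ having a polar decomposition with $\nu_\xi(\mathrm{d}r)=\ell_\xi(r)\mathrm{d}r$, where $\ell_\xi(r)$ is measurable in $(\xi,r)$ and nonincreasing and right-continuous in $r>0$. *)

(* Defs.v *)
From HB Require Import structures.
From mathcomp Require Import all_boot all_order all_algebra.
From mathcomp Require Import all_classical all_reals all_analysis.
From mathcomp Require Import measurable_realfun.
Set Implicit Arguments. Unset Strict Implicit. Unset Printing Implicit Defensive.
Import Order.TTheory GRing.Theory Num.Theory.
Import numFieldNormedType.Exports.
Local Open Scope classical_set_scope.
Local Open Scope ring_scope.

Notation Rd R d := (g_sigma_algebraType (@open 'rV[R]_d)).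

Definition enorm (R : realType) (d : nat) (x : Rd R d) : R :=
  Num.sqrt (\sum_(i < d) (x : 'rV[R]_d) 0 i ^+ 2).

Definition smul (R : realType) (d : nat) (r : R) (x : Rd R d) : Rd R d :=
  (r *: (x : 'rV[R]_d)) : 'rV[R]_d.

Definition sphere (R : realType) (d : nat) : set (Rd R d) :=
  [set x | enorm x = 1].
Arguments sphere R d : clear implicits.

Definition origin (R : realType) (d : nat) : Rd R d := (0 : 'rV[R]_d).
Arguments origin R d : clear implicits.

Local Open Scope ereal_scope.
Definition levy_p (R : realType) (d : nat) (p : nat)
    (nu : {measure set (Rd R d) -> \bar R}) : Prop :=
  nu [set origin R d] = 0 /\
  \int[nu]_(x in setT) (Order.min 1 (enorm x ^+ p))%:E < +oo.

Definition levy (R : realType) (d : nat) (nu : {measure set (Rd R d) -> \bar R}) :=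
  levy_p 2 nu.

Local Close Scope ereal_scope.
Definition pos_reals (R : realType) : set R := `]0%R, +oo[%classic.
Arguments pos_reals R : clear implicits.

Definition a_1 (R : realType) (r s : R) : R :=
  if (0 < r)%R && (r < Num.sqrt s)%R
  then 2 / pi * (Num.sqrt (s - r ^+ 2))^-1 else 0.
Definition a_2 (R : realType) (r s : R) : R :=
  if (0 < r)%R && (r < s)%R
  then 2 / pi * (Num.sqrt (s ^+ 2 - r ^+ 2))^-1 else 0.
Definition a_k (R : realType) (k : nat) : R -> R -> R :=
  if k == 1%N then @a_1 R else @a_2 R.

Local Open Scope ereal_scope.
Definition A_op (R : realType) (d : nat) (k : nat)
    (nu : {measure set (Rd R d) -> \bar R}) (B : set (Rd R d)) : \bar R :=
  \int[nu]_(x in ~` [set origin R d])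
     \int[lebesgue_measure]_(r in (pos_reals R))
        (a_k k r (enorm x) * \1_B (smul (r / enorm x) x))%:E.

Definition agree (R : realType) (d : nat) (f g : set (Rd R d) -> \bar R) :=
  forall B, measurable B -> f B = g B.

Definition range_A (R : realType) (d : nat) (k : nat) :
    set (set (Rd R d) -> \bar R) :=
  [set f | exists nu : {measure set (Rd R d) -> \bar R},
     levy_p k nu /\ agree f (A_op k nu)].

Definition polar_decomposition (R : realType) (d : nat)
    (nu : {measure set (Rd R d) -> \bar R})
    (lam : {measure set (Rd R d) -> \bar R})
    (nuxi : Rd R d -> {measure set R -> \bar R}) : Prop :=
  lam (~` (sphere R d)) = 0 /\
  (forall xi, nuxi xi (~` (pos_reals R)) = 0) /\
  (forall E, measurable E ->
     measurable_fun (sphere R d) ((fun xi => nuxi xi E) : Rd R d -> \bar R)) /\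
  (forall xi, sphere R d xi ->
     0 < nuxi xi (pos_reals R)) /\
  (forall B, measurable B ->
     nu B = \int[lam]_(xi in sphere R d)
              \int[nuxi xi]_(r in (pos_reals R))
                 (\1_B (smul r xi))%:E).

Definition jurek_class (R : realType) (d : nat) : set (set (Rd R d) -> \bar R) :=
  [set f | exists nu : {measure set (Rd R d) -> \bar R},
     levy nu /\ agree f nu /\
     exists (lam : {measure set (Rd R d) -> \bar R})
            (nuxi : Rd R d -> {measure set R -> \bar R})
            (l : Rd R d -> R -> R),
       polar_decomposition nu lam nuxi /\
       measurable_fun (sphere R d `*` (pos_reals R))
         (fun p : Rd R d * R => l p.1 p.2) /\
       (forall xi r, sphere R d xi -> (0 < r)%R -> (0 <= l xi r)%R) /\
       (forall xi, sphere R d xi ->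
          {in `]0%R, +oo[ &, {homo l xi : r s /~ (r <= s)%R}}) /\
       (forall xi r, sphere R d xi -> (0 < r)%R ->
          (l xi) @ at_right r --> l xi r) /\
       (forall xi E, sphere R d xi -> measurable E ->
          nuxi xi E = \int[lebesgue_measure]_(r in E `&` (pos_reals R))
                         (l xi r)%:E)].
Arguments jurek_class R d : clear implicits.
Arguments range_A R d k : clear implicits.

(* Main.v *)
(** Since [a_2 r s = a_1 r (s ^ 2)], the transform [A_2 nu] is [A_1] of the image
    of [nu] under [x |-> |x| x], a bijection carrying [levy_p 2] to [levy_p 1];
    hence the two ranges coincide.

    For the inclusion, a nonincreasing right-continuous density is a mixture of
    uniform laws on intervals ]0, w[, [w] being the widths of its level sets.
    Each of these is an arcsine mixture: if [u] is uniform on ]0, w[, then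
    [A_1] maps the law of [w ^ 2 - u ^ 2] to the uniform law on ]0, w[, because
    [a_1 r (w ^ 2 - u ^ 2) = a_1 u (w ^ 2 - r ^ 2)] and [a_1 _ c] is a
    probability density. The bound [min 1 |x| <= 4 pi A_1 (min 1 |.| ^ 2)] shows
    that the mixing measure is in the domain [levy_p 1].

    The inclusion is strict because [A_1] of a unit Dirac mass has an increasing
    radial density, whereas measures of the Jurek class give more mass to the
    inner one of two disjoint shells of equal thickness. *)
Require Import Defs.
From HB Require Import structures.
From mathcomp Require Import all_boot all_order all_algebra.
From mathcomp Require Import all_classical all_reals all_analysis.
From mathcomp Require Import measurable_realfun.
From mathcomp Require Import ring lra.
Set Implicit Arguments. Unset Strict Implicit. Unset Printing Implicit Defensive.
Import Order.TTheory GRing.Theory Num.Theory.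
Import numFieldNormedType.Exports.
Local Open Scope classical_set_scope.
Local Open Scope ring_scope.

(** * Measurability in [Rd R d] *)

Lemma measurable_sqrt (R : realType) d (T : measurableType d) (f : T -> R) :
  measurable_fun setT f -> measurable_fun setT (fun x => Num.sqrt (f x)).
Proof.
move=> mf; rewrite (_ : (fun _ => _) = Num.sqrt \o f) //.
exact: (measurableT_comp (continuous_measurable_fun (@sqrt_continuous R))).
Qed.

Section euclidean.
Context (R : realType) (d : nat).
Implicit Types x : Rd R d.

Lemma measurable_coord (i : 'I_d) :
  measurable_fun [set: Rd R d] (fun x : Rd R d => (x : 'rV[R]_d) 0 i).
Proof.
apply: (measurability _ (RGenOpens.measurableE R)).
move=> _ [_ [a [b ->] <-]]; rewrite setTI; apply: sub_sigma_algebra.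
have /continuousP := @coord_continuous R 1 d 0 i.
by apply; exact: interval_open.
Qed.

(** Density of the rationals puts around each point of [U] a ball with rational centre and radius.
    The index set is countable, so measurability of preimages of open sets reduces to preimages of
    balls. *)
Lemma rV_open_bigcup_ball (U : set 'rV[R]_d) : open U ->
  U = \bigcup_(p in [set p : 'rV[rat]_d * rat | 0 < p.2 /\
        ball (map_mx (@ratr R) p.1) (ratr p.2) `<=` U])
      ball (map_mx (@ratr R) p.1) (ratr p.2).
Proof.
move=> oU; apply/seteqP; split => [x Ux|x [p [_ +]]]; last exact.
have /nbhs_ballP[e /= e0 eU] : nbhs x U by exact: open_nbhs_nbhs.
have e2 : 0 < e / 2 by rewrite divr_gt0.
have [q] := rat_in_itvoo e2; rewrite in_itv /= => /andP[q0 qe].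
(* Each coordinate of the centre is chosen less than [q] below that of [x]; then [q < e / 2] keeps
   the whole ball within [e] of [x]. *)
have rat_near i : exists r : rat, x 0 i - ratr q < ratr r < x 0 i.
  have : x 0 i - ratr q < x 0 i by rewrite gtrBl.
  by move/rat_in_itvoo => [r]; rewrite in_itv /=; exists r.
have [f fP] := choice rat_near.
pose c := \row_i f i.
have cx : ball (map_mx (@ratr R) c) (ratr q) x.
  split => // i j; rewrite !mxE ord1 -ball_normE /=.
  have := fP j; rewrite ltr_norml => /andP[? ?]; lra.
exists (c, q) => //=; split; first by rewrite -(ltr0q R).
move=> y cy; apply: eU; rewrite (splitr e); apply: (@ball_triangle _ _ (map_mx (@ratr R) c)).
  by apply: le_ball (ball_sym cx); exact: ltW.
by apply: le_ball cy; exact: ltW.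
Qed.

(** Balls of row vectors are products of coordinate intervals, so the preimage of a ball is a finite
    intersection over the coordinates. *)
Lemma measurable_to_Rd d' (T : measurableType d') (f : T -> Rd R d) :
  (forall i, measurable_fun [set: T] (fun t => (f t : 'rV[R]_d) 0 i)) ->
  measurable_fun [set: T] f.
Proof.
move=> mf; apply: (@measurability _ _ T (Rd R d) setT f (@open 'rV[R]_d) erefl).
move=> _ [U oU <-].
rewrite (rV_open_bigcup_ball oU) setTI preimage_bigcup.
rewrite bigcup_mkcond; apply: countable_bigcupT_measurable => // -[c q].
case: ifPn => // /set_mem[/= q0 _].
rewrite (_ : _ @^-1` _ = \bigcap_(i in [set: 'I_d])
    ((fun t => (f t : 'rV[R]_d) 0 i) @^-1` ball (ratr (c 0 i) : R) (ratr q))).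
  apply: fin_bigcap_measurable => // i _.
  rewrite -[X in measurable X]setTI; apply: mf => //; exact: measurable_ball.
apply/seteqP; split => t /=.
  by case=> _ h i _ /=; move: (h 0 i); rewrite mxE.
by move=> h; split => [|i j]; rewrite ?ltr0q// ord1 mxE; exact: h.
Qed.

Lemma measurable_smul :
  measurable_fun [set: R * Rd R d] (fun p : R * Rd R d => smul p.1 p.2).
Proof.
apply: measurable_to_Rd => i; rewrite /smul.
under eq_fun do rewrite mxE.
apply: measurable_funM => //.
exact: (measurableT_comp (measurable_coord i) measurable_snd).
Qed.

Lemma measurable_enorm : measurable_fun [set: Rd R d] (@enorm R d).
Proof.
rewrite /enorm; apply: measurable_sqrt; apply: measurable_sum => i; apply: measurable_funX; exact: measurable_coord.
Qed.

Lemma enorm_ge0 x : 0 <= enorm x. Proof. exact: sqrtr_ge0. Qed.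

Lemma enorm_smul r x : enorm (smul r x) = `|r| * enorm x.
Proof.
rewrite /enorm /smul -sqrtr_sqr -sqrtrM ?sqr_ge0// mulr_sumr.
by congr Num.sqrt; apply: eq_bigr => i _; rewrite mxE exprMn.
Qed.

Lemma enorm_eq0 x : (enorm x == 0) = (x == origin R d).
Proof.
rewrite /enorm sqrtr_eq0 le_eqVlt ltNge sumr_ge0 ?orbF; last first.
  by move=> i _; exact: sqr_ge0.
rewrite psumr_eq0 => [|i _]; last exact: sqr_ge0.
apply/allP/eqP => [h|-> i _]; last by rewrite /= mxE expr0n.
apply/rowP => i; rewrite mxE; apply/eqP.
by have := h i (mem_index_enum _); rewrite /= sqrf_eq0.
Qed.

Lemma enorm_gt0 x : (0 < enorm x) = (x != origin R d).
Proof. by rewrite lt0r enorm_eq0 enorm_ge0 andbT. Qed.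

Lemma smulA r s x : smul r (smul s x) = smul (r * s) x.
Proof. exact: scalerA. Qed.

Lemma smul1 x : smul 1 x = x. Proof. exact: scale1r. Qed.

Lemma set_origin : [set origin R d] = (@enorm R d) @^-1` [set 0].
Proof.
apply/seteqP; split => x /=; first by move=> ->; apply/eqP; rewrite enorm_eq0.
by move/eqP; rewrite enorm_eq0 => /eqP.
Qed.

Lemma measurable_origin : measurable [set origin R d].
Proof.
rewrite set_origin -[X in measurable X]setTI.
exact: measurable_enorm.
Qed.

End euclidean.

(** * The arcsine kernel *)

Section arcsine.
Context (R : realType).
Implicit Types c r s u w : R.

(** No sign condition on [s] is imposed: for [s <= 0] the value [Num.sqrt s = 0] makes both sides
    false. Hence [a_1 r s] vanishes for nonpositive [s], which later spares case distinctions. *)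
Lemma ltr_sqrt_sqr r s : 0 < r -> (r < Num.sqrt s) = (r ^+ 2 < s).
Proof.
move=> r0; have [s0|s0] := ltP 0 s.
  by rewrite -{1}(gtr0_norm r0) -sqrtr_sqr ltr_sqrt.
rewrite ler0_sqrtr// [LHS]ltNge ltW//=; apply/esym/negbTE.
by rewrite -leNgt (le_trans s0)// sqr_ge0.
Qed.

Lemma a_1E r s : 0 < r ->
  a_1 r s = if r ^+ 2 < s then 2 / pi * (Num.sqrt (s - r ^+ 2))^-1 else 0.
Proof. by move=> r0; rewrite /a_1 r0/= ltr_sqrt_sqr. Qed.

Lemma a_1_ge0 r s : 0 <= a_1 r s.
Proof.
rewrite /a_1; case: ifP => // _.
by rewrite mulr_ge0 ?invr_ge0 ?sqrtr_ge0// divr_ge0 ?pi_ge0.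
Qed.

Lemma a_2E r s : 0 <= s -> a_2 r s = a_1 r (s ^+ 2).
Proof. by move=> s0; rewrite /a_1 /a_2 sqrtr_sqr ger0_norm. Qed.

(** Both sides depend on [r] and [u] only through [w ^+ 2 - r ^+ 2 - u ^+ 2], and are nonzero
    exactly when it is positive. *)
Lemma a_1_swap r u w : 0 < r -> 0 < u ->
  a_1 r (w ^+ 2 - u ^+ 2) = a_1 u (w ^+ 2 - r ^+ 2).
Proof.
move=> r0 u0; rewrite !a_1E//.
have -> : (r ^+ 2 < w ^+ 2 - u ^+ 2) = (u ^+ 2 < w ^+ 2 - r ^+ 2).
  by apply/idP/idP => ?; lra.
by rewrite addrAC.
Qed.

Lemma measurable_invr_ge0 d (T : measurableType d) (f : T -> R) :
  (forall x, 0 <= f x) -> measurable_fun setT f ->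
  measurable_fun setT (fun x => (f x)^-1).
Proof.
(* On nonnegative values inversion is the power of exponent -1, even at 0, where both give 0. *)
move=> f0 mf; rewrite (_ : (fun _ => _) = (fun x => powR x (-1)) \o f).
  by apply: measurableT_comp => //; exact: measurable_powR.
by apply/funext => x /=; rewrite powR_inv1.
Qed.

Lemma measurable_a_1 d (T : measurableType d) (f g : T -> R) :
  measurable_fun setT f -> measurable_fun setT g ->
  measurable_fun setT (fun x => a_1 (f x) (g x)).
Proof.
move=> mf mg; rewrite /a_1; apply: measurable_fun_ifT => //.
  apply: measurable_and; apply: measurable_fun_ltr => //.
  exact: measurable_sqrt.
apply: measurable_funM => //; apply: measurable_invr_ge0.
  by move=> x; exact: sqrtr_ge0.
apply: measurable_sqrt.
by apply: measurable_funB => //; exact: measurable_funX.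
Qed.

(** The distribution function of the arcsine law on []0, Num.sqrt c[]; [arcsin'] is its density,
    that is [a_1 _ c] without the cutoff. *)
Let arcsin c u : R := 2 / pi * asin (u / Num.sqrt c).

Let arcsin' c u : R := 2 / pi * (Num.sqrt (c - u ^+ 2))^-1.

Let is_derive_arcsin c u : 0 < c -> u ^+ 2 < c ->
  is_derive u 1 (arcsin c) (arcsin' c u).
Proof.
move=> c0 uc; have s0 : 0 < Num.sqrt c by rewrite sqrtr_gt0.
have us : -1 < u / Num.sqrt c < 1.
  rewrite -ltr_norml normrM normfV (gtr0_norm s0) ltr_pdivrMr// mul1r.
  by rewrite -sqrtr_sqr ltr_sqrt.
have := is_derive1_asin us.
rewrite /arcsin => Dasin.
have Du : is_derive u 1 (fun u : R => u / Num.sqrt c) (Num.sqrt c)^-1.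
  rewrite (_ : (fun _ => _) = (Num.sqrt c)^-1 *: id); last first.
    by apply/funext => x; rewrite mulrC.
  by apply: is_derive_eq; rewrite scaler1.
have D := @is_derive1_comp _ asin (fun u => u / Num.sqrt c) _ _ _ Dasin Du.
have -> : arcsin' c u = (2 / pi) *: ((Num.sqrt (1 - (u / Num.sqrt c) ^+ 2))^-1 *
    (Num.sqrt c)^-1).
  rewrite /arcsin' /GRing.scale/=; congr (_ * _); rewrite -invfM -sqrtrM; last first.
    by rewrite subr_ge0 expr_div_n (sqr_sqrtr (ltW c0)) ler_pdivrMr// mul1r ltW.
  congr (Num.sqrt _)^-1; rewrite mulrBl mul1r expr_div_n (sqr_sqrtr (ltW c0)).
  by rewrite divfK// gt_eqF.
exact: is_deriveZ.
Qed.

Let integral_arcsin' c b : 0 < c -> 0 < b -> b ^+ 2 < c ->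
  (\int[lebesgue_measure]_(u in `[0%R, b]) (arcsin' c u)%:E = (arcsin c b)%:E)%E.
Proof.
move=> c0 b0 bc.
have sub u : u \in `[0, b] -> u ^+ 2 < c.
  rewrite in_itv/= => /andP[u0 ub]; apply: le_lt_trans bc.
  by rewrite ler_sqr ?nnegrE// ltW.
have D u : u \in `[0, b] -> is_derive u 1 (arcsin c) (arcsin' c u).
  by move=> /sub; exact: is_derive_arcsin.
have C u : u \in `[0, b] -> {for u, continuous (arcsin c)}.
  move=> /D Du; apply/differentiable_continuous/derivable1_diffP.
  exact: ex_derive.
rewrite (@continuous_FTC2 _ _ (arcsin c)) //.
- have -> : arcsin c 0 = 0.
    rewrite /arcsin mul0r -{1}sin0 sinK ?mulr0// in_itv/=.
    by have := pi_ge0 R; rewrite oppr_le0 => p0; rewrite divr_ge0.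
  by rewrite sube0.
- apply: continuous_in_subspaceT => u; rewrite inE /= => /sub uc.
  rewrite /arcsin'; apply: cvgM; first exact: cvg_cst.
  apply: cvgV; first by rewrite gt_eqF// sqrtr_gt0 subr_gt0.
  apply: (continuous_comp (f := fun u => c - u ^+ 2)); last exact: sqrt_continuous.
  by apply: cvgB; [exact: cvg_cst|apply: exprn_continuous].
- split.
  + by move=> u /subset_itv_oo_cc/D Du; exact: ex_derive.
  + by apply: cvg_at_right_filter; apply: C; rewrite in_itv/= lexx ltW.
  + by apply: cvg_at_left_filter; apply: C; rewrite in_itv/= lexx ltW.
- by move=> u /subset_itv_oo_cc/D Du; rewrite derive1E; exact: derive_val.
Qed.

Let ler_sin : {in `[- (pi / 2), pi / 2] &, {mono @sin R : x y / x <= y}}.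
Proof. by apply: le_mono_in => x y xpi ypi xy; rewrite ltr_sin. Qed.

(** The density blows up at [s = Num.sqrt c], so the fundamental theorem of calculus is applied on
    the compact intervals [[0, s * sin (theta n)]], where the mass is exactly [2 / pi * theta n].
    Monotone convergence concludes as [theta n] increases to [pi / 2]. *)
Lemma integral_a_1 c : 0 < c ->
  (\int[lebesgue_measure]_(u in pos_reals R) (a_1 u c)%:E = 1)%E.
Proof.
move=> c0; pose s := Num.sqrt c; have s0 : 0 < s by rewrite sqrtr_gt0.
have s2 : s ^+ 2 = c by rewrite sqr_sqrtr// ltW.
(* The shift by 2 keeps [theta n] positive: the subtracted term is below 1, and [1 <= pi / 2]. *)
pose theta n : R := pi / 2 - n.+2%:R^-1.
have thetaP n : 0 < theta n < pi / 2.
  rewrite /theta subr_gt0 ltrBlDr ltrDl invr_gt0 ltr0n andbT.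
  by apply: lt_le_trans (pihalf_ge1 R); rewrite invf_lt1// ltr1n.
have sint n : 0 < sin (theta n) < 1.
  have /andP[t0 tpi] := thetaP n.
  apply/andP; split; first by apply: sin_gt0_pi; rewrite t0/= (lt_trans tpi)//; have := pi_gt0 R; lra.
  rewrite -sin_pihalf ltr_sin// in_itv/=; apply/andP; split => //; have := pi_gt0 R; lra.
pose F n := `[0, s * sin (theta n)]%classic.
have FE n : (\int[lebesgue_measure]_(u in F n) (arcsin' c u)%:E =
    (2 / pi * theta n)%:E)%E.
  have /andP[t0 t1] := sint n.
  rewrite integral_arcsin' ?mulr_gt0//; last first.
    by rewrite exprMn s2 gtr_pMr// expr_lt1// ltW.
  rewrite /arcsin -/s (mulrC s) mulfK ?gt_eqF// sinK// in_itv/=.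
  have /andP[? ?] := thetaP n; apply/andP; split; have := pi_gt0 R; lra.
have ndF : nondecreasing_seq F.
  apply/nondecreasing_seqP => n; rewrite subsetEset => u.
  rewrite /F /= !in_itv/= => /andP[-> /le_trans]; apply.
  have /andP[m0 m1] := thetaP n; have /andP[k0 k1] := thetaP n.+1.
  have := pi_gt0 R => p0.
  rewrite ler_pM2l// ler_sin ?in_itv/=; [|apply/andP; split; lra..].
  by rewrite lerB// lef_pV2 ?posrE// ler_nat.
have UF : \bigcup_n F n = `[0, s[%classic.
  apply/seteqP; split => u.
    move=> [n _]; rewrite /F /= !in_itv/= => /andP[-> us] /=.
    by apply: le_lt_trans us _; rewrite gtr_pMr//; case/andP: (sint n).
  rewrite /= in_itv/=.
  have us0 : 0 <= u -> u < s -> 0 <= u / s < 1.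
    by move=> u0 us; rewrite divr_ge0 ?(ltW s0)//= ltr_pdivrMr// mul1r.
  case/andP=> u0 /(us0 u0)/andP[us1 us2].
  have usN1 : -1 <= u / s by rewrite (le_trans _ us1)// lerN10.
  have := @asin_ltpi2 R (u / s); rewrite usN1 us2 => /(_ isT) t1.
  have t0 := @asin_geNpi2 R (u / s).
  (* The point [u] enters [F n] once [theta n] reaches [asin (u / s)], which lies strictly below
     [pi / 2]. *)
  have [n nP] : exists n : nat, n.+2%:R^-1 <= pi / 2 - asin (u / s).
    exists (Num.truncn (pi / 2 - asin (u / s))^-1).
    have h : 0 < pi / 2 - asin (u / s) by rewrite subr_gt0.
    rewrite -[leRHS]invrK lef_pV2 ?posrE ?invr_gt0//.
    by rewrite (le_trans (ltW (truncnS_gt _)))// ler_nat.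
  exists n => //; rewrite /F /= in_itv/= u0/=.
  rewrite -ler_pdivrMl// mulrC -{1}(@asinK R (u / s)) ?in_itv/= ?usN1 ?(ltW us2)//.
  have /andP[m0 m1] := thetaP n; have := pi_gt0 R => p0.
  have {}t0 : - (pi / 2) <= asin (u / s) by apply: t0; rewrite usN1 ltW.
  rewrite ler_sin ?in_itv/=; [|apply/andP; split; lra..].
  by rewrite /theta lerBrDl -lerBrDr.
have mf : measurable_fun setT (fun u => (arcsin' c u)%:E).
  apply/measurable_EFinP; apply: measurable_funM => //.
  apply: measurable_invr_ge0; first by move=> u; exact: sqrtr_ge0.
  apply: measurable_sqrt; apply: measurable_funB => //; exact: measurable_funX.
have f0 u : (0 <= (arcsin' c u)%:E)%E.
  by rewrite lee_fin mulr_ge0 ?invr_ge0 ?sqrtr_ge0// divr_ge0 ?pi_ge0.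
(* The endpoint 0 is a null set, and [a_1 _ c] vanishes from [s] on. *)
have -> : (\int[lebesgue_measure]_(u in pos_reals R) (a_1 u c)%:E =
    \int[lebesgue_measure]_(u in `[0%R, s[) (arcsin' c u)%:E)%E.
  rewrite -[RHS]integral_itv_obnd_cbnd; last exact: measurable_funTS.
  rewrite integral_mkcond [RHS]integral_mkcond; apply: eq_integral => u _.
  rewrite !patchE !mem_setE !in_itv/= andbT; case: ifPn => u0 //=.
  rewrite a_1E// /arcsin' -(ltr_sqrt_sqr _ u0) -/s.
  by case: ifPn.
have cvgF : (\int[lebesgue_measure]_(u in F n) (arcsin' c u)%:E @[n --> \oo] -->
    \int[lebesgue_measure]_(u in `[0%R, s[) (arcsin' c u)%:E)%E.
  rewrite -UF; apply: ge0_nondecreasing_set_cvg_integral => //.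
    by move=> i; exact: measurable_itv.
  by move=> i; exact: measurable_funTS.
rewrite -(cvg_lim (@ereal_hausdorff R) cvgF).
have cvgT : 2 / pi * theta n @[n --> \oo] --> (1 : R).
  have E : 2 / pi * (pi / 2 - 0) = 1 :> R.
    have pi0 : pi != 0 :> R by rewrite gt_eqF// pi_gt0.
    by rewrite subr0 mulf_div (mulrC pi) divff// mulf_neq0.
  suff : 2 / pi * theta n @[n --> \oo] --> (2 / pi * (pi / 2 - 0) : R) by rewrite E.
  apply: cvgM; first exact: cvg_cst.
  apply: cvgB; first exact: cvg_cst.
  have := @cvg_harmonic R; rewrite -(cvg_shiftn 1).
  by under eq_fun do rewrite /= addn1.
apply/cvg_lim => //; under eq_fun do rewrite FE.
by apply: cvg_EFin; [exact: nearW|exact: cvgT].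
Qed.

End arcsine.

(** * The two arcsine transforms have the same range *)

Section transport.
Local Open Scope ereal_scope.
Context d1 d2 (T1 : measurableType d1) (T2 : measurableType d2) (R : realType).

Lemma ge0_integral_mrestr (mu : {measure set T1 -> \bar R}) (D : set T1)
    (mD : measurable D) (f : T1 -> \bar R) :
  measurable_fun setT f -> (forall x, 0 <= f x) ->
  \int[mrestr mu mD]_x f x = \int[mu]_(x in D) f x.
Proof.
move=> mf f0; rewrite [LHS](ge0_negligible_integral (measurableC mD))//; last first.
  by rewrite /= /mrestr setICl measure0.
rewrite setTD setCK; apply: eq_measure_integral => A mA AD.
by rewrite /= /mrestr setIidl.
Qed.

(** Restriction to [D] followed by push-forward along [q]. Every measure built below arises this
    way, and only its values and the change of variables are used. *)
Lemma transport_measure (mu : {measure set T1 -> \bar R}) (D : set T1)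
    (q : T1 -> T2) : measurable D -> measurable_fun setT q ->
  exists nu : {measure set T2 -> \bar R},
    (forall B, measurable B -> nu B = mu (q @^-1` B `&` D)) /\
    (forall g : T2 -> \bar R, measurable_fun setT g -> (forall y, 0 <= g y) ->
      \int[nu]_y g y = \int[mu]_(x in D) g (q x)).
Proof.
move=> mD mq.
pose muD : {measure set T1 -> \bar R} := mrestr mu mD.
unshelve epose (nu := (pushforward muD q : {measure set T2 -> \bar R})).
  exact: mq.
exists nu; split => // g mg g0.
rewrite (ge0_integral_pushforward mq muD)// preimage_setT ge0_integral_mrestr//.
  exact: measurableT_comp.
by move=> x; exact: g0.
Qed.

End transport.

(** * Averages over the arcsine law along a ray *)

Section arcsine_average.
Context (R : realType) (d : nat).
Local Notation T := (Rd R d).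
Implicit Types (x : T) (g : T -> R).

(** The integral of [g] against the image under [A_1] of the Dirac mass at [x]. Beyond indicators,
    it is applied to the truncated squared norm, to control the mixing measure near the origin and
    at infinity. *)
Definition arcsine_avg g x : \bar R :=
  (\int[lebesgue_measure]_(r in pos_reals R)
     (a_1 r (enorm x) * g (smul (r / enorm x) x))%:E)%E.

Lemma arcsine_avg_ge0 g x : (forall y, 0 <= g y) -> (0 <= arcsine_avg g x)%E.
Proof.
by move=> g0; apply: integral_ge0 => r _; rewrite lee_fin mulr_ge0// a_1_ge0.
Qed.

Lemma measurable_pos_reals : measurable (pos_reals R).
Proof. exact: measurable_itv. Qed.

Lemma measurable_arcsine_avg g : measurable_fun setT g -> (forall y, 0 <= g y) ->
  measurable_fun setT (arcsine_avg g).
Proof.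
move=> mg g0.
pose F (p : T * R) : \bar R :=
  ((a_1 p.2 (enorm p.1) * g (smul (p.2 / enorm p.1) p.1)) * \1_(pos_reals R) p.2)%:E.
have mF : measurable_fun setT F.
  apply/measurable_EFinP; apply: measurable_funM; last first.
    apply: (measurableT_comp _ measurable_snd).
    exact: (measurable_indic measurable_pos_reals).
  have mn : measurable_fun setT (fun p : T * R => enorm p.1).
    exact: (measurableT_comp (@measurable_enorm R d) measurable_fst).
  apply: measurable_funM; first exact: measurable_a_1.
  apply: (measurableT_comp mg).
  pose h (p : T * R) := (p.2 / enorm p.1, p.1).
  apply: (measurableT_comp (@measurable_smul R d) (g := h)).
  apply: measurable_fun_pair => //; apply: measurable_funM => //.
  by apply: measurable_invr_ge0 => // p; exact: enorm_ge0.
have F0 p : (0 <= F p)%E.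
  by rewrite lee_fin mulr_ge0// mulr_ge0// a_1_ge0.
have := @measurable_fun_fubini_tonelli_F _ _ _ _ _ (@lebesgue_measure R) _ mF F0.
apply: eq_measurable_fun => x _; rewrite /fubini_F /arcsine_avg [RHS]integral_mkcond.
apply: eq_integral => r _; rewrite /F /= patchE indicE.
by case: ifPn => _; rewrite ?mulr1 ?mulr0.
Qed.

Lemma arcsine_avg_indic_ge0 (B : set T) x : (0 <= arcsine_avg \1_B x)%E.
Proof. by apply: arcsine_avg_ge0 => y; rewrite indicE. Qed.

Lemma measurable_arcsine_avg_indic (B : set T) : measurable B ->
  measurable_fun setT (arcsine_avg \1_B).
Proof. by move=> mB; apply: measurable_arcsine_avg. Qed.

Lemma A_op1E (nu : {measure set T -> \bar R}) B :
  A_op 1 nu B = (\int[nu]_(x in ~` [set origin R d]) arcsine_avg \1_B x)%E.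
Proof. by []. Qed.

Definition square_radius x : T := smul (enorm x) x.
Definition sqrt_radius x : T := smul (Num.sqrt (enorm x))^-1 x.

(** Away from the origin [square_radius] keeps the direction and squares the norm, and [a_2E] turns
    [a_2] at a radius into [a_1] at its square. *)
Lemma A_op2E (nu : {measure set T -> \bar R}) B :
  A_op 2 nu B =
  (\int[nu]_(x in ~` [set origin R d]) arcsine_avg \1_B (square_radius x))%E.
Proof.
apply: eq_integral => x; rewrite inE /= => /eqP x0.
rewrite /arcsine_avg /square_radius enorm_smul ger0_norm ?enorm_ge0//.
apply: eq_integral => r _; rewrite /a_k/= a_2E ?enorm_ge0// -expr2 smulA.
by rewrite expr2 invfM mulrA divfK// enorm_eq0.
Qed.

Lemma smul_origin r : smul r (origin R d) = origin R d.
Proof. exact: scaler0. Qed.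

Lemma measurable_smul_fun (c : T -> R) : measurable_fun setT c ->
  measurable_fun setT (fun x => smul (c x) x).
Proof.
move=> mc; apply: (measurableT_comp (@measurable_smul R d) (g := fun x => (c x, x))).
exact: measurable_fun_pair.
Qed.

Lemma measurable_square_radius : measurable_fun setT square_radius.
Proof. exact: (measurable_smul_fun (@measurable_enorm R d)). Qed.

Lemma measurable_sqrt_radius : measurable_fun setT sqrt_radius.
Proof.
apply: measurable_smul_fun; apply: measurable_invr_ge0.
  by move=> x; exact: sqrtr_ge0.
exact: measurable_sqrt (@measurable_enorm R d).
Qed.

Lemma enorm_square_radius x : enorm (square_radius x) = enorm x ^+ 2.
Proof. by rewrite enorm_smul ger0_norm ?enorm_ge0. Qed.

Lemma enorm_sqrt_radius x : enorm (sqrt_radius x) ^+ 2 = enorm x.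
Proof.
rewrite enorm_smul ger0_norm ?invr_ge0 ?sqrtr_ge0// exprMn exprVn.
rewrite sqr_sqrtr ?enorm_ge0//; have [->|x0] := eqVneq (enorm x) 0.
  by rewrite expr0n mulr0.
by rewrite expr2 mulrA mulVf// mul1r.
Qed.

Lemma square_radiusK x : square_radius (sqrt_radius x) = x.
Proof.
have [->|x0] := eqVneq x (origin R d).
  by rewrite /square_radius /sqrt_radius !smul_origin.
rewrite {1}/square_radius {2}/sqrt_radius smulA enorm_smul.
rewrite ger0_norm ?invr_ge0 ?sqrtr_ge0// mulrAC -invfM -expr2.
by rewrite sqr_sqrtr ?enorm_ge0// mulVf ?smul1// enorm_eq0.
Qed.

Lemma square_radius_eq0 x : (square_radius x == origin R d) = (x == origin R d).
Proof. by rewrite -enorm_eq0 enorm_square_radius sqrf_eq0 enorm_eq0. Qed.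

Lemma sqrt_radius_eq0 x : (sqrt_radius x == origin R d) = (x == origin R d).
Proof. by rewrite -[in RHS](square_radiusK x) square_radius_eq0. Qed.

(** Covers both inclusions between the ranges: [sqrt_radius] with [n = 2], [m = 1], and
    [square_radius] with [n = 1], [m = 2]. The norm relation makes the two truncated moments equal,
    and only the origin is sent to the origin. *)
Lemma levy_p_image (n m : nat) (q : T -> T) (nu : {measure set T -> \bar R}) :
  measurable_fun setT q ->
  (forall x, (q x == origin R d) = (x == origin R d)) ->
  (forall x, enorm (q x) ^+ n = enorm x ^+ m) -> levy_p m nu ->
  exists2 nu' : {measure set T -> \bar R}, levy_p n nu' &
    forall h : T -> \bar R, measurable_fun setT h -> (forall x, (0 <= h x)%E) ->
    (\int[nu']_(x in ~` [set origin R d]) h x =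
     \int[nu]_(x in ~` [set origin R d]) h (q x))%E.
Proof.
move=> mq q0 qn [nu0 nufin].
have [nu' [nu'E nu'int]] := transport_measure nu measurableT mq.
have mO := @measurable_origin R d.
exists nu' => [|h mh h0]; first split.
- rewrite nu'E ?setIT// -[RHS]nu0; congr (nu _).
  by apply/seteqP; split => x /= /eqP; [rewrite q0 => /eqP|rewrite -q0 => /eqP].
- rewrite nu'int; last 2 first.
  + apply/measurable_EFinP; apply: measurable_minr => //.
    by apply: measurable_funX; exact: measurable_enorm.
  + by move=> x; rewrite lee_fin le_min ler01 exprn_ge0// enorm_ge0.
  by under eq_integral do rewrite qn.
- rewrite integral_mkcond [RHS]integral_mkcond nu'int; last 2 first.
  + by apply/(measurable_restrictT _ (measurableC mO)); exact: measurable_funTS.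
  + by apply: erestrict_ge0.
  by apply: eq_integral => x _; rewrite !patchE !in_setC !in_set1 q0.
Qed.

Lemma range_A1_A2 : range_A R d 1 = range_A R d 2.
Proof.
apply/seteqP; split => f [nu [lnu fE]].
- have [nu' lnu' nu'int] := levy_p_image (n := 2) (m := 1)
    measurable_sqrt_radius sqrt_radius_eq0 enorm_sqrt_radius lnu.
  exists nu'; split => // B mB; rewrite fE// A_op1E A_op2E nu'int.
  + by apply: eq_integral => x _; rewrite square_radiusK.
  + apply: (measurableT_comp _ measurable_square_radius).
    exact: measurable_arcsine_avg_indic.
  + by move=> x; exact: arcsine_avg_indic_ge0.
- have [nu' lnu' nu'int] := levy_p_image (n := 1) (m := 2)
    measurable_square_radius square_radius_eq0 enorm_square_radius lnu.
  exists nu'; split => // B mB; rewrite fE// A_op1E A_op2E nu'int//.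
  + exact: measurable_arcsine_avg_indic.
  + by move=> x; exact: arcsine_avg_indic_ge0.
Qed.

End arcsine_average.

(** * The arcsine law is not of the Jurek class *)

Section not_jurek.
Context (R : realType) (d : nat).
Local Notation T := (Rd R d).
Local Open Scope ereal_scope.

Definition shell (a b : R) : set T := [set x | (a < enorm x <= b)%R].

Lemma shellP a b : shell a b = @enorm R d @^-1` `]a, b]%classic.
Proof. by apply/seteqP; split => x; rewrite /shell /= in_itv. Qed.

Lemma measurable_enorm_preimage (E : set R) : measurable E ->
  measurable (@enorm R d @^-1` E).
Proof.
by move=> mE; rewrite -[X in measurable X]setTI; exact: measurable_enorm.
Qed.

Lemma measurable_shell a b : measurable (shell a b).
Proof. by rewrite shellP; apply: measurable_enorm_preimage; exact: measurable_itv. Qed.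

Lemma measurable_sphere : measurable (sphere R d).
Proof.
rewrite (_ : sphere R d = @enorm R d @^-1` [set 1%R])//.
exact: measurable_enorm_preimage.
Qed.

(** A unit direction [xi] satisfies [|r xi| = r] for [r > 0], so the ray through [xi] meets the
    preimage of [E] exactly in the radii of [E]. *)
Lemma polar_radial nu lam nuxi (E : set R) :
  @polar_decomposition R d nu lam nuxi -> measurable E -> E `<=` pos_reals R ->
  nu (@enorm R d @^-1` E) = \int[lam]_(xi in sphere R d) nuxi xi E.
Proof.
move=> [_ [_ [_ [_ nuE]]]] mE Epos; rewrite nuE; last exact: measurable_enorm_preimage.
apply: eq_integral => xi; rewrite inE /sphere /= => xi1.
rewrite -[X in nuxi xi X](setIidl Epos) -integral_indic//; last first.
  exact: measurable_pos_reals.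
apply: eq_integral => r; rewrite inE /pos_reals /= in_itv/= andbT => r0.
rewrite !indicE; congr (_%:R)%:E; congr nat_of_bool.
by apply/idP/idP; rewrite !inE /= enorm_smul xi1 mulr1 gtr0_norm.
Qed.

Lemma smul_shell a b (r : R) (xi : T) : enorm xi = 1%R -> (0 < r)%R ->
  (smul r xi \in shell a b) = (a < r <= b)%R.
Proof.
move=> xi1 r0; rewrite -{3}[r]gtr0_norm// -{2}[r]gtr0_norm//.
by rewrite -[`|r|%R]mulr1 -xi1 -enorm_smul; apply/idP/idP; rewrite inE.
Qed.

Lemma integral_cst_itv (c k h : R) : (0 <= h)%R ->
  \int[lebesgue_measure]_(r in `]c, (c + h)%R]) k%:E = (k * h)%:E.
Proof.
move=> h0; rewrite integral_cst//= lebesgue_measure_itv/= lte_fin ltrDl.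
case: ltP => hh; first by rewrite -EFinB addrAC subrr add0r.
by have -> : h = 0%R by [apply/eqP; rewrite eq_le h0 hh]; rewrite mulr0 mule0.
Qed.

(** Along each direction the density is at most [l xi b] on the outer interval and, because
    [a + h <= b], at least [l xi b] on the inner one. Both masses are compared with [l xi b * h]
    before integrating over directions. *)
Lemma jurek_shell_le (f : set T -> \bar R) (a b h : R) :
  jurek_class R d f -> (0 <= a)%R -> (a + h <= b)%R -> (0 <= h)%R ->
  f (shell b (b + h)) <= f (shell a (a + h)).
Proof.
move=> [nu [_ [fE [lam [nuxi [l [pol [ml [l0 [ldec [_ lE]]]]]]]]]]].
move=> a0 ahb h0; have ab : (a <= b)%R by rewrite (le_trans _ ahb)// lerDl.
have cpos c : (0 <= c)%R -> `]c, (c + h)%R]%classic `<=` pos_reals R.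
  move=> c0 r; rewrite /pos_reals /= !in_itv/= andbT => /andP[+ _].
  exact: le_lt_trans.
have shellE c : (0 <= c)%R -> nu (shell c (c + h)) =
    \int[lam]_(xi in sphere R d) nuxi xi `]c, (c + h)%R]%classic.
  by move=> c0; rewrite shellP (polar_radial pol)//; exact: cpos.
rewrite !fE; try exact: measurable_shell.
rewrite !shellE//; last exact: le_trans ab.
have [_ [_ [mnuxi _]]] := pol.
have msphere := measurable_sphere.
apply: ge0_le_integral => //; [exact: mnuxi|exact: mnuxi|].
move=> xi xi1.
have mitv (c : R) : measurable (`]c, (c + h)%R]%classic : set R) by exact: measurable_itv.
have lEc c : (0 <= c)%R -> nuxi xi `]c, (c + h)%R]%classic =
    \int[lebesgue_measure]_(r in `]c, (c + h)%R]) (l xi r)%:E.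
  move=> c0; rewrite lE// setIidl// => r; rewrite /pos_reals /=.
  by rewrite !in_itv/= andbT => /andP[+ _]; exact: le_lt_trans.
have mlc c : (0 <= c)%R ->
    measurable_fun (`]c, (c + h)%R]%classic : set R) (fun r => (l xi r)%:E).
  move=> c0; apply/measurable_EFinP.
  apply: (@measurable_funS _ _ _ _ (pos_reals R)) => //.
  - exact: measurable_pos_reals.
  - move=> r; rewrite /pos_reals /= !in_itv/= andbT => /andP[+ _].
    exact: le_lt_trans.
  - apply: (@measurable_comp _ _ _ _ _ _ _ (fun p : T * R => l p.1 p.2) _
      (fun r => (xi, r)) _ _ ml) => //.
    + by apply: measurableX => //; exact: measurable_pos_reals.
    + by move=> _ [r rp <-].
    + by apply: measurable_funTS; exact: pair1_measurable.
have b0 : (0 <= b)%R by exact: le_trans ab.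
(* Monotonicity of [l xi] is known only at positive radii, and [b = 0] is possible when [h = 0]; the
   intervals are then empty. *)
have lb : (0 < h -> 0 < b)%R by move=> hp; rewrite (lt_le_trans _ ahb)// ltr_wpDl.
rewrite !lEc//; apply: (@le_trans _ _ (l xi b * h)%:E).
  rewrite -(integral_cst_itv b)//; apply: ge0_le_integral => //.
  - move=> r /=; rewrite in_itv/= => /andP[br _]; rewrite lee_fin l0//.
    exact: le_lt_trans br.
  - exact: mlc.
  - move=> r /=; rewrite in_itv/= => /andP[br rbh]; rewrite lee_fin.
    have hp : (0 < h)%R by rewrite -(ltrDl b) (lt_le_trans br).
    by apply: ldec; rewrite ?in_itv/= ?andbT ?(lb hp) ?(ltW br) ?(le_lt_trans b0 br).
rewrite -(integral_cst_itv a)//; apply: ge0_le_integral => //.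
- move=> r /=; rewrite in_itv/= => /andP[ar rah]; rewrite lee_fin l0//.
  by apply: lb; rewrite -(ltrDl a) (lt_le_trans ar).
- exact: mlc.
- move=> r /=; rewrite in_itv/= => /andP[ar rah]; rewrite lee_fin.
  have hp : (0 < h)%R by rewrite -(ltrDl a) (lt_le_trans ar).
  by apply: ldec; rewrite ?in_itv/= ?andbT ?(lb hp) ?(le_trans rah ahb)
    ?(le_lt_trans a0 ar).
Qed.

Lemma arcsine_avg_shell (e : T) (a b : R) : enorm e = 1%R -> (0 <= a)%R ->
  arcsine_avg \1_(shell a b) e =
  \int[lebesgue_measure]_(r in `]a, b]) (a_1 r 1)%:E.
Proof.
move=> e1 a0; rewrite /arcsine_avg integral_mkcond [RHS]integral_mkcond.
apply: eq_integral => r _; rewrite !patchE !mem_setE !in_itv/= andbT e1 divr1.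
case: (ltP 0%R r) => r0; last first.
  by rewrite [(a < r)%R]ltNge (le_trans r0 a0).
rewrite indicE smul_shell//.
by case: ifP; rewrite ?mulr1 ?mulr0.
Qed.

Lemma measurable_a_11 (D : set R) : measurable_fun D (fun r => (a_1 r 1)%:E).
Proof. by apply/measurable_EFinP/measurable_funTS; apply: measurable_a_1. Qed.

Lemma a_1_1E (r : R) : (0 < r < 1)%R ->
  a_1 r 1 = (2 / pi * (Num.sqrt (1 - r ^+ 2))^-1)%R.
Proof. by move=> /andP[r0 r1]; rewrite a_1E// expr_lt1 ?ltW// r1. Qed.

Lemma a_1_1_le (r s : R) : (0 < r)%R -> (r <= s)%R -> (s < 1)%R ->
  (a_1 r 1 <= a_1 s 1)%R.
Proof.
move=> r0 rs s1; have s0 : (0 < s)%R by exact: lt_le_trans rs.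
have r1 : (r < 1)%R by exact: le_lt_trans s1.
rewrite !a_1_1E ?r0 ?s0//= ler_pM2l ?divr_gt0 ?pi_gt0//.
have s2 : (s ^+ 2 < 1)%R by rewrite expr_lt1// ltW.
have rs2 : (r ^+ 2 <= s ^+ 2)%R by rewrite ler_sqr ?nnegrE ?(ltW r0) ?(ltW s0).
rewrite lef_pV2 ?posrE ?sqrtr_gt0 ?subr_gt0//; last exact: le_lt_trans s2.
by rewrite ler_wsqrtr// lerB.
Qed.

Lemma a_1_1_lt (r s : R) : (0 < r)%R -> (r < s)%R -> (s < 1)%R ->
  (a_1 r 1 < a_1 s 1)%R.
Proof.
move=> r0 rs s1; have s0 : (0 < s)%R by exact: lt_trans rs.
have r1 : (r < 1)%R by exact: lt_trans s1.
rewrite !a_1_1E ?r0 ?s0//= ltr_pM2l ?divr_gt0 ?pi_gt0//.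
have s2 : (s ^+ 2 < 1)%R by rewrite expr_lt1// ltW.
have rs2 : (r ^+ 2 < s ^+ 2)%R by rewrite ltr_sqr ?nnegrE ?(ltW r0) ?(ltW s0).
rewrite ltf_pV2 ?posrE ?sqrtr_gt0 ?subr_gt0//; last exact: lt_trans s2.
by rewrite ltr_sqrt; lra.
Qed.

Lemma enorm_delta (i : 'I_d) : enorm (delta_mx ord0 i : 'rV[R]_d) = 1%R.
Proof.
rewrite /enorm (bigD1 i)//= !mxE !eqxx expr1n big1 ?addr0 ?sqrtr1// => j ji.
by rewrite !mxE eqxx/= (negbTE ji) expr0n.
Qed.

Lemma A_op1_dirac (e : T) B : measurable B -> e != origin R d ->
  A_op 1 (\d_ e) B = arcsine_avg \1_B e.
Proof.
move=> mB e0; rewrite A_op1E integral_dirac.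
- by rewrite diracE mem_set ?mul1e//=; exact/eqP.
- exact: (measurableC (@measurable_origin R d)).
- by apply: measurable_funTS; exact: measurable_arcsine_avg_indic.
Qed.

(** The density [a_1 _ 1] increases on []0, 1[]. The shell []0, 1/4]] has mass at most
    [a_1 (1/4) 1 / 4], which is strictly less than [a_1 (1/2) 1 / 4], a lower bound for the mass of
    []1/2, 3/4]]; this contradicts [jurek_shell_le]. *)
Lemma A_op1_dirac_not_jurek (e : T) : enorm e = 1%R ->
  ~ jurek_class R d (A_op 1 (\d_ e)).
Proof.
move=> e1 J.
have e0 : e != origin R d by rewrite -enorm_gt0 e1.
have := @jurek_shell_le _ 0%R (1/2)%R (1/4)%R J.
rewrite !(A_op1_dirac (measurable_shell _ _) e0).
rewrite !arcsine_avg_shell ?divr_ge0//.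
move=> /(_ (lexx _)).
have h1 : (0 + 1 / 4 <= 1 / 2 :> R)%R by lra.
move=> /(_ h1 isT); apply/negP; rewrite -ltNge.
have h2 : (0 <= 1 / 4 :> R)%R by lra.
apply: (@le_lt_trans _ _ (a_1 (1 / 4) 1 * (1 / 4))%:E).
  rewrite -(integral_cst_itv 0%R _ h2); apply: ge0_le_integral => //.
  - by move=> r _; rewrite lee_fin a_1_ge0.
  - exact: measurable_a_11.
  - move=> r /=; rewrite in_itv/= => /andP[ar rah]; rewrite lee_fin.
    by apply: a_1_1_le => //; lra.
apply: (@lt_le_trans _ _ (a_1 (1 / 2) 1 * (1 / 4))%:E).
  by rewrite lte_fin ltr_pM2r ?divr_gt0// a_1_1_lt//; lra.
rewrite -(integral_cst_itv (1 / 2)%R _ h2); apply: ge0_le_integral => //.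
- by move=> r _; rewrite lee_fin a_1_ge0.
- exact: measurable_a_11.
- move=> r /=; rewrite in_itv/= => /andP[ar rah]; rewrite lee_fin.
  by apply: a_1_1_le => //; lra.
Qed.

Lemma range_A1_dirac (e : T) : enorm e = 1%R -> range_A R d 1 (A_op 1 (\d_ e)).
Proof.
move=> e1; exists (\d_ e); split; [split|by []].
  rewrite /= diracE memNset// => /= /eqP.
  by rewrite -enorm_eq0 e1 oner_eq0.
rewrite integral_dirac//.
  by rewrite diracT mul1e ltry.
apply/measurable_EFinP; apply: measurable_minr => //.
by apply: measurable_funX; exact: measurable_enorm.
Qed.

End not_jurek.

(** * Uniform laws as arcsine mixtures *)

Lemma mem_pos_reals (R : realType) (r : R) : (r \in pos_reals R) = (0 < r).
Proof. by rewrite /pos_reals mem_setE in_itv/= andbT. Qed.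

Section arcsine_identity.
Context (R : realType).
Implicit Types (w r u : R) (h : R -> R).
Local Notation leb := (@lebesgue_measure R).
Local Open Scope ereal_scope.

(** For [r < w] this is the total mass of an arcsine law; otherwise the parameter is nonpositive and
    the kernel is zero. *)
Lemma integral_a_1_sqr w r : (0 <= w)%R -> (0 < r)%R ->
  \int[leb]_(u in pos_reals R) (a_1 u (w ^+ 2 - r ^+ 2))%:E = (r < w)%R%:R%:E.
Proof.
move=> w0 r0; case: ltP => [rw|wr].
  by rewrite integral_a_1// subr_gt0 ltr_sqr ?nnegrE// ltW.
apply: integral0_eq => u; rewrite /pos_reals /= in_itv/= andbT => u0.
rewrite a_1E// ifF//; apply/negbTE; rewrite -leNgt.
rewrite (@le_trans _ _ 0%R) ?sqr_ge0// subr_le0 ler_sqr ?nnegrE//.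
exact: ltW.
Qed.

(** After Tonelli and [a_1_swap], the inner integral over [u] is the mass computed in
    [integral_a_1_sqr], namely the indicator of [r < w]. Leaving the uniform laws unnormalised
    allows [w = 0]. *)
Lemma arcsine_mixture w h : (0 <= w)%R -> measurable_fun setT h ->
  (forall r, 0 <= h r)%R ->
  \int[leb]_(u in `]0%R, w[) \int[leb]_(r in pos_reals R)
      (a_1 r (w ^+ 2 - u ^+ 2) * h r)%:E =
  \int[leb]_(r in `]0%R, w[) (h r)%:E.
Proof.
move=> w0 mh h0.
(* The swapped kernel, extended by zero to the plane. The constraint [u < w] need not be encoded,
   since the kernel vanishes for [u >= w]. *)
pose F (p : R * R) : \bar R := (\1_(pos_reals R) p.1 * \1_(pos_reals R) p.2 *
  (a_1 p.1 (w ^+ 2 - p.2 ^+ 2) * h p.2))%:E.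
have mpos : measurable_fun setT (\1_(pos_reals R) : R -> R).
  by apply: measurable_indic; exact: measurable_pos_reals.
have mF : measurable_fun setT F.
  apply/measurable_EFinP; apply: measurable_funM.
    by apply: measurable_funM; exact: (measurableT_comp mpos).
  apply: measurable_funM; last exact: (measurableT_comp mh).
  apply: measurable_a_1 => //; apply: measurable_funB => //.
  exact: measurable_funX.
have F0 p : 0 <= F p by rewrite lee_fin !mulr_ge0// a_1_ge0.
transitivity (\int[leb]_u \int[leb]_r F (u, r)).
  rewrite integral_mkcond; apply: eq_integral => u _; rewrite patchE mem_setE in_itv/=.
  case: (ltP 0%R u) => [u0|u0] /=; last first.
    apply/esym/integral0_eq => r _.
    by rewrite /F /= indicE mem_pos_reals ltNge u0 !mul0r.
  case: (ltP u w) => [uw|wu].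
    rewrite integral_mkcond; apply: eq_integral => r _; rewrite patchE /F /= !indicE.
    rewrite !mem_pos_reals u0 mul1r.
    by case: ifP => r0; rewrite ?mul0r// mul1r a_1_swap.
  apply/esym/integral0_eq => r _; rewrite /F /= !indicE !mem_pos_reals.
  case: (ltP 0%R r) => r0; last by rewrite mulr0 mul0r.
  rewrite a_1_swap// a_1E// ifF ?mul0r ?mulr0//; apply/negbTE; rewrite -leNgt.
  rewrite (@le_trans _ _ 0%R) ?sqr_ge0// subr_le0 ler_sqr ?nnegrE//.
  exact: ltW.
rewrite (fubini_tonelli (m1 := leb) (m2 := leb) F mF F0).
rewrite [RHS]integral_mkcond; apply: eq_integral => r _.
rewrite patchE mem_setE in_itv/=; case: (ltP 0%R r) => [r0|r0] /=; last first.
  apply/integral0_eq => u _.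
  by rewrite /F /= !indicE !mem_pos_reals (le_gtF r0) mulr0 mul0r.
transitivity ((h r)%:E * \int[leb]_(u in pos_reals R) (a_1 u (w ^+ 2 - r ^+ 2))%:E).
  have mpos' := @measurable_pos_reals R.
  have ma : measurable_fun (pos_reals R) (fun u => (a_1 u (w ^+ 2 - r ^+ 2))%:E).
    by apply/measurable_EFinP; apply: measurable_funTS; exact: measurable_a_1.
  have a0 u : pos_reals R u -> 0 <= (a_1 u (w ^+ 2 - r ^+ 2))%:E.
    by move=> _; rewrite lee_fin a_1_ge0.
  rewrite -ge0_integralZl// ?lee_fin//.
  rewrite [RHS]integral_mkcond; apply: eq_integral => u _.
  rewrite patchE /F /= !indicE !mem_pos_reals r0 mulr1.
  by case: ifP; rewrite ?mul0r// mul1r mulrC EFinM.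
rewrite integral_a_1_sqr//; case: ifP => _; rewrite ?mule1 ?mule0//.
Qed.

End arcsine_identity.

(** * Truncated moments under the arcsine transform *)

Section lower_bound.
Context (R : realType) (d : nat).
Local Open Scope ereal_scope.
Local Notation leb := (@lebesgue_measure R).

(** With [q = Num.sqrt s], only radii in []q / 2, q[] are kept. There the kernel is at least
    [2 / (pi q)] and the truncated square at least [min 1 s / 4]; multiplying by the length [q / 2]
    gives [min 1 s / (4 pi)]. *)
Lemma arcsine_avg_min_ge (x : Rd R d) : x != origin R d ->
  (Num.min 1 (enorm x))%:E <= (4 * pi)%:E *
    arcsine_avg (fun y : Rd R d => (Num.min 1 (enorm y ^+ 2))%R) x.
Proof.
have key (p q m : R) : (p != 0 -> q != 0 ->
    m / (4 * p) = 2 / p * q^-1 * (m / 4) * (q / 2))%R.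
  by move=> p0 q0; field; rewrite p0 q0.
rewrite -enorm_gt0 => s0; set s := enorm x in s0 *.
have q0 : (0 < Num.sqrt s)%R by rewrite sqrtr_gt0.
have q2 : (Num.sqrt s ^+ 2 = s)%R by rewrite sqr_sqrtr// ltW.
set q := Num.sqrt s in q0 q2.
have mpi : (Num.min 1 s)%:E = (4 * pi)%:E * (Num.min 1 s / (4 * pi))%:E.
  by rewrite -EFinM mulrC divfK// mulf_neq0// gt_eqF// pi_gt0.
rewrite {1}mpi lee_pmul2l ?lte_fin ?mulr_gt0 ?pi_gt0//.
pose c := (2 / pi * q^-1 * (Num.min 1 s / 4))%R.
have -> : (Num.min 1 s / (4 * pi))%:E = \int[leb]_(r in `](q / 2)%R, q[) c%:E.
  rewrite integral_cst//= lebesgue_measure_itv/= lte_fin.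
  rewrite ifT; last by lra.
  rewrite -EFinB -EFinM; congr EFin; rewrite /c.
  have -> : (q - q / 2 = q / 2)%R by lra.
  by apply: key; rewrite gt_eqF// pi_gt0.
have -> : arcsine_avg (fun y : Rd R d => (Num.min 1 (enorm y ^+ 2))%R) x =
    \int[leb]_(r in pos_reals R) (a_1 r s * (Num.min 1 (r ^+ 2))%R)%:E.
  apply: eq_integral => r; rewrite inE /pos_reals /= in_itv/= andbT => r0.
  by rewrite enorm_smul -/s gtr0_norm ?divr_gt0// divfK// gt_eqF.
have sub : `](q / 2)%R, q[ `<=` pos_reals R.
  by move=> r; rewrite /pos_reals /= !in_itv/= andbT => /andP[+ _]; lra.
have g0 (r : R) : 0 <= (a_1 r s * (Num.min 1 (r ^+ 2))%R)%:E.
  by rewrite lee_fin mulr_ge0 ?a_1_ge0// le_min ler01 sqr_ge0.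
have mg D : measurable_fun D (fun r : R => (a_1 r s * (Num.min 1 (r ^+ 2))%R)%:E).
  apply/measurable_EFinP; apply: measurable_funTS; apply: measurable_funM.
    exact: measurable_a_1.
  by apply: measurable_minr => //; exact: measurable_funX.
apply: (@le_trans _ _ (\int[leb]_(r in `](q / 2)%R, q[)
    (a_1 r s * Num.min 1 (r ^+ 2))%:E)); last first.
  by have mpos := @measurable_pos_reals R; apply: ge0_subset_integral => //; exact: mg.
have c0 : (0 <= c)%R.
  by rewrite /c !mulr_ge0 ?invr_ge0 ?pi_ge0 ?(ltW q0)// le_min ler01 ltW.
apply: ge0_le_integral => //; first exact: mg.
move=> r /=; rewrite in_itv/= => /andP[r1 r2].
have r0 : (0 < r)%R by lra.
have rs : (r ^+ 2 < s)%R by rewrite -q2 ltr_sqr ?nnegrE ?(ltW r0) ?(ltW q0).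
rewrite lee_fin a_1E// rs /c; apply: ler_pM.
- by rewrite !mulr_ge0 ?invr_ge0 ?pi_ge0 ?(ltW q0).
- by rewrite mulr_ge0// le_min ler01 ltW.
- rewrite ler_pM2l ?divr_gt0 ?pi_gt0// lef_pV2 ?posrE// ?sqrtr_gt0 ?subr_gt0//.
  by rewrite ler_wsqrtr// gerBl sqr_ge0.
- have r4 : (s / 4 <= r ^+ 2)%R.
    have -> : (s / 4 = (q / 2) ^+ 2)%R by rewrite expr_div_n q2; lra.
    by rewrite ler_sqr ?nnegrE ?(ltW r0) ?(ltW r1)// divr_ge0// ltW.
  have m1 : (Num.min 1 s <= 1)%R by rewrite ge_min lexx.
  have m2 : (Num.min 1 s <= s)%R by rewrite ge_min lexx orbT.
  by rewrite le_min; apply/andP; split; lra.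
Qed.

End lower_bound.

(** * Measures with radial densities *)

(** The exhausting sequences are nondecreasing, so a pair whose components enter at [n] and [m] lies
    in the rectangle of index [maxn n m]. *)
Lemma product_measure1_sigma_finite d1 d2 (T1 : measurableType d1)
    (T2 : measurableType d2) (R : realType)
    (m1 : {sigma_finite_measure set T1 -> \bar R})
    (m2 : {sigma_finite_measure set T2 -> \bar R}) :
  sigma_finite setT (m1 \x m2)%E.
Proof.
have /sigma_finiteP[A [TA ndA Afin]] := sigma_finiteT m1.
have /sigma_finiteP[B [TB ndB Bfin]] := sigma_finiteT m2.
exists (fun n => A n `*` B n) => [|n]; last first.
  have [[mA Aoo] [mB Boo]] := (Afin n, Bfin n); split; first exact: measurableX.
  by rewrite product_measure1E// lte_mul_pinfty// ge0_fin_numE.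
apply/seteqP; split => // -[x y] _.
have [n _ Anx] : (\bigcup_n A n) x by rewrite -TA.
have [m _ Bmy] : (\bigcup_n B n) y by rewrite -TB.
exists (maxn n m) => //; split => /=.
  by move: x Anx; apply/subsetPset/ndA; exact: leq_maxl.
by move: y Bmy; apply/subsetPset/ndB; exact: leq_maxr.
Qed.

Section triple_integral.
Context d (T : measurableType d) (R : realType).
Variable lam : {sigma_finite_measure set T -> \bar R}.
Local Open Scope ereal_scope.
Local Notation leb := (@lebesgue_measure R).

(** One space carries two parametrisations: its points are read as direction, radius, height in
    [hypograph], and as direction, height, mixing variable in [below_width]. *)
Definition triple : {measure set (T * measurableTypeR R * measurableTypeR R)%type -> \bar R} :=
  ((lam \x leb) \x leb).

Lemma triple_integral (F : (T * R * R)%type -> \bar R) :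
  measurable_fun setT F -> (forall q, 0 <= F q) ->
  \int[triple]_q F q = \int[lam]_x \int[leb]_a \int[leb]_b F (x, a, b).
Proof.
move=> mF F0.
pose m : {sigma_finite_measure set (T * measurableTypeR R)%type -> \bar R} :=
  HB.pack (lam \x leb) (Measure_isSigmaFinite.Build _ _ _ (lam \x leb)
    (product_measure1_sigma_finite lam leb)).
rewrite (fubini_tonelli1 (m1 := m) (m2 := leb) F)//.
rewrite (fubini_tonelli1 (m1 := lam) (m2 := leb))//.
  exact: measurable_fun_fubini_tonelli_F.
by move=> p; apply: integral_ge0.
Qed.

End triple_integral.

(** * Level sets of a nonincreasing radial density and the mixing measure *)

Section radial_density.
Context (R : realType) (d : nat).
Local Notation T := (Rd R d).
Local Notation leb := (@lebesgue_measure R).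
Local Open Scope ereal_scope.
(** [L] stands for the density extended by zero off unit directions and positive radii. [L_right] is
    the form in which right continuity enters, and [L_vanish] makes the level sets of positive
    height bounded. *)
Variables (lam : {sigma_finite_measure set T -> \bar R}) (L : T -> R -> R).
Hypothesis mL : measurable_fun setT (fun p : T * R => L p.1 p.2).
Hypothesis L_ge0 : forall x r, (0 <= L x r)%R.
Hypothesis L_supp : forall x r, (0 < L x r)%R -> enorm x = 1%R /\ (0 < r)%R.
Hypothesis L_nonincr : forall x r s, (0 < r)%R -> (r <= s)%R -> (L x s <= L x r)%R.
Hypothesis L_right : forall x r y, (0 < r)%R -> (y < L x r)%R ->
  exists2 s, (r < s)%R & (y < L x s)%R.
Hypothesis L_vanish : forall x y, (0 < y)%R -> exists2 r, (0 < r)%R & (L x r <= y)%R.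

Definition level_set (x : T) (y : R) : set R := [set r | (y < L x r)%R].

(** An infinite length is turned into 0 by [fine]; this can happen only at heights [p.2 <= 0], which
    [below_width] excludes. *)
Definition level_width (p : T * R) : R := fine (leb (level_set p.1 p.2)).

Lemma measurable_level : measurable [set q : T * R * R | (q.1.2 < L q.1.1 q.2)%R].
Proof.
rewrite -[X in measurable X]setTI.
have := @measurable_fun_ltr _ (T * R * R)%type R setT (fun q => q.1.2)
  (fun q => L q.1.1 q.2).
move=> /(_ _ _ measurableT [set true]).
rewrite (_ : _ @^-1` [set true] = [set q : T * R * R | (q.1.2 < L q.1.1 q.2)%R])//.
apply => //.
  exact: (measurableT_comp measurable_snd measurable_fst).
apply: (measurableT_comp mL (g := fun q : T * R * R => (q.1.1, q.2))).
apply: measurable_fun_pair => //.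
exact: (measurableT_comp measurable_fst measurable_fst).
Qed.

Lemma level_setE p : level_set p.1 p.2 =
  xsection [set q : T * R * R | (q.1.2 < L q.1.1 q.2)%R] p.
Proof. by apply/seteqP; split => r /=; rewrite /xsection /= inE. Qed.

Lemma measurable_level_set x y : measurable (level_set x y).
Proof.
rewrite (level_setE (x, y)); apply: measurable_xsection; exact: measurable_level.
Qed.

Lemma measurable_level_width : measurable_fun setT level_width.
Proof.
apply: measurableT_comp; first exact: fine_measurable.
under eq_fun do rewrite level_setE.
exact: (measurable_fun_xsection leb measurable_level).
Qed.

Lemma level_width_ge0 p : (0 <= level_width p)%R.
Proof. exact: fine_ge0. Qed.

Lemma leb_itv0c (a : R) : (0 <= a)%R -> leb `]0%R, a]%classic = a%:E.
Proof.
move=> a0; rewrite /= lebesgue_measure_itv/= lte_fin sube0.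
by case: ltP => // a0'; congr EFin; apply/eqP; rewrite eq_le a0 a0'.
Qed.

Lemma level_set_sub x y r : (0 < y)%R -> (0 < r)%R -> (L x r <= y)%R ->
  level_set x y `<=` `]0%R, r]%classic.
Proof.
move=> y0 r0 ry s /= ys; rewrite in_itv/=.
have [_ s0] := L_supp (lt_trans y0 ys); rewrite s0/= leNgt; apply/negP => rs.
by have := le_trans (L_nonincr x r0 (ltW rs)) ry; rewrite leNgt ys.
Qed.

(** By [L_vanish] the density is at most [y] at some radius [r], hence beyond it too, so the level
    set lies in []0, r]]. *)
Lemma level_width_fin x y : (0 < y)%R ->
  leb (level_set x y) = (level_width (x, y))%:E.
Proof.
move=> y0; rewrite fineK//; have [r r0 ry] := L_vanish x y0.
rewrite ge0_fin_numE//; apply: (@le_lt_trans _ _ (leb `]0%R, r]%classic)).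
  apply: le_measure; rewrite ?inE; [exact: measurable_level_set|exact: measurable_itv|].
  exact: level_set_sub.
by rewrite leb_itv0c ?ltry// ltW.
Qed.

(* Right continuity makes each level set an open interval, whose length then
   decides membership. *)
Lemma lt_level_width x y r : (0 < y)%R -> (0 < r)%R ->
  (r < level_width (x, y))%R = (y < L x r)%R.
Proof.
move=> y0 r0; rewrite -lte_fin -level_width_fin//.
case: (ltP y (L x r)) => [yr|ry]; last first.
  apply/negbTE; rewrite -leNgt -(leb_itv0c (ltW r0)).
  apply: le_measure; rewrite ?inE; [exact: measurable_level_set|exact: measurable_itv|].
  exact: level_set_sub.
have [s rs ys] := L_right r0 yr.
apply: (@lt_le_trans _ _ s%:E); first by rewrite lte_fin.
rewrite -leb_itv0c ?(ltW (lt_trans r0 rs))//.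
apply: le_measure; rewrite ?inE; [exact: measurable_itv|exact: measurable_level_set|].
move=> t /=; rewrite in_itv/= => /andP[t0 ts].
by apply: lt_le_trans (L_nonincr x t0 ts).
Qed.

Lemma level_width_gt0 x y : (0 < y)%R -> (0 < level_width (x, y))%R -> enorm x = 1%R.
Proof.
(* Half the width is a radius in the level set, where [L] is positive. *)
move=> y0 w0; have h : (level_width (x, y) / 2 < level_width (x, y))%R by lra.
move: h; rewrite lt_level_width// ?divr_gt0// => h.
by have [] := L_supp (lt_trans y0 h).
Qed.

(** The region under the graph of [L]; its image under [hypograph_pos] is the measure with radial
    density [L]. *)
Definition hypograph : set (T * R * R)%type :=
  [set q | (0 < q.2)%R && (q.2 < L q.1.1 q.1.2)%R].

(** For each height [y], the points [u] of []0, w[], with [w] the width at that height. Its image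
    under [below_width_pos], at radius [w ^+ 2 - u ^+ 2], is the mixing measure. *)
Definition below_width : set (T * R * R)%type :=
  [set q | [&& (0 < q.1.2)%R, (0 < q.2)%R & (q.2 < level_width q.1)%R]].

Definition hypograph_pos (q : T * R * R) : T := smul q.1.2 q.1.1.

Definition below_width_pos (q : T * R * R) : T :=
  smul (level_width q.1 ^+ 2 - q.2 ^+ 2) q.1.1.

Let measurable_true d' (X : measurableType d') (P : X -> bool) :
  measurable_fun setT P -> measurable [set x | P x].
Proof.
move=> /(_ measurableT [set true]); rewrite setTI.
by rewrite (_ : _ @^-1` [set true] = [set x | P x])//; apply.
Qed.

Lemma measurable_hypograph : measurable hypograph.
Proof.
apply: measurable_true; apply: measurable_and; apply: measurable_fun_ltr => //.
exact: (measurableT_comp mL measurable_fst).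
Qed.

Lemma measurable_below_width : measurable below_width.
Proof.
apply: measurable_true; do 2?apply: measurable_and; apply: measurable_fun_ltr => //.
  exact: (measurableT_comp measurable_snd measurable_fst).
exact: (measurableT_comp measurable_level_width measurable_fst).
Qed.

Lemma measurable_hypograph_pos : measurable_fun setT hypograph_pos.
Proof.
apply: (measurableT_comp (@measurable_smul R d)
  (g := fun q : T * R * R => (q.1.2, q.1.1))).
apply: measurable_fun_pair.
  exact: (measurableT_comp measurable_snd measurable_fst).
exact: (measurableT_comp measurable_fst measurable_fst).
Qed.

Lemma measurable_below_width_pos : measurable_fun setT below_width_pos.
Proof.
apply: (measurableT_comp (@measurable_smul R d)
  (g := fun q : T * R * R => (level_width q.1 ^+ 2 - q.2 ^+ 2, q.1.1)%R)).
apply: measurable_fun_pair; last first.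
  exact: (measurableT_comp measurable_fst measurable_fst).
apply: measurable_funB; apply: measurable_funX => //.
exact: (measurableT_comp measurable_level_width measurable_fst).
Qed.

Lemma below_width_posP q : below_width q ->
  [/\ enorm q.1.1 = 1%R, enorm (below_width_pos q) = (level_width q.1 ^+ 2 - q.2 ^+ 2)%R
    & (0 < level_width q.1 ^+ 2 - q.2 ^+ 2)%R].
Proof.
case: q => [[x y] u] /and3P[/= y0 u0 uw].
have w0 : (0 < level_width (x, y))%R by exact: lt_trans uw.
have x1 := level_width_gt0 y0 w0.
have c0 : (0 < level_width (x, y) ^+ 2 - u ^+ 2)%R.
  by rewrite subr_gt0 ltr_sqr ?nnegrE// ltW.
by split => //; rewrite /below_width_pos /= enorm_smul x1 mulr1 gtr0_norm.
Qed.

Lemma below_width_pos_neq0 q : below_width q -> below_width_pos q != origin R d.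
Proof. by move=> /below_width_posP[_ e c]; rewrite -enorm_gt0 e. Qed.

Lemma arcsine_avg_below_width (g : T -> R) q : below_width q ->
  arcsine_avg g (below_width_pos q) = \int[leb]_(r in pos_reals R)
    (a_1 r (level_width q.1 ^+ 2 - q.2 ^+ 2) * g (smul r q.1.1))%:E.
Proof.
move=> Dq; have [x1 e c] := below_width_posP Dq.
rewrite /arcsine_avg e; apply: eq_integral => r _.
by rewrite /below_width_pos smulA divfK// gt_eqF.
Qed.

(** By Tonelli the comparison can be made height by height. At [y > 0] the section of the hypograph
    is []0, level_width (x, y)[], where [arcsine_mixture] applies to [g] along the ray; at [y <= 0]
    both sides vanish. *)
Lemma arcsine_fiber (g : T -> R) x : measurable_fun setT g ->
  (forall y, 0 <= g y)%R ->
  \int[leb]_y \int[leb]_u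
    ((fun q => arcsine_avg g (below_width_pos q)) \_ below_width) (x, y, u) =
  \int[leb]_r \int[leb]_y
    ((fun q => (g (hypograph_pos q))%:E) \_ hypograph) (x, r, y).
Proof.
move=> mg g0.
have mgx : measurable_fun setT (fun r => g (smul r x)).
  apply: (measurableT_comp mg).
  apply: (measurableT_comp (@measurable_smul R d) (g := fun r => (r, x))).
  exact: pair2_measurable.
(* The coordinates are exchanged so that the height comes first, as in [below_width]. *)
pose H (p : R * R) := ((fun q => (g (hypograph_pos q))%:E) \_ hypograph) (x, p.2, p.1).
have mH : measurable_fun setT H.
  apply: (measurableT_comp
    (f := (fun q => (g (hypograph_pos q))%:E) \_ hypograph)
    (g := fun p : R * R => (x, p.2, p.1))).
    apply/(measurable_restrictT _ measurable_hypograph)/measurable_funTS.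
    by apply/measurable_EFinP; exact: (measurableT_comp mg measurable_hypograph_pos).
  by apply: measurable_fun_pair => //; apply: measurable_fun_pair.
have H0 p : 0 <= H p by apply: erestrict_ge0 => q _; rewrite lee_fin.
transitivity (\int[leb]_y \int[leb]_r H (y, r)); last first.
  exact: (fubini_tonelli (m1 := leb) (m2 := leb) H mH H0).
apply: eq_integral => y _.
case: (ltP 0%R y) => [y0|y0]; last first.
  rewrite !integral0_eq// => u _.
    rewrite /H patchE ifF//; apply/negbTE/negP.
    by rewrite inE /hypograph /= (le_gtF y0).
  rewrite patchE ifF//; apply/negbTE/negP.
  by rewrite inE /below_width /= (le_gtF y0).
have := arcsine_mixture (level_width_ge0 (x, y)) mgx (fun r => g0 (smul r x)).
rewrite integral_mkcond [X in _ = X -> _]integral_mkcond => E.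
transitivity (\int[leb]_r ((fun r0 : R => (g (smul r0 x))%:E) \_
    `]0%R, level_width (x, y)[) r).
  rewrite -E; apply: eq_integral => u _; rewrite !patchE.
  have -> : ((x, y, u) \in below_width) = (0 < u < level_width (x, y))%R.
    by apply/idP/idP; rewrite inE /below_width /= y0.
  rewrite mem_setE in_itv/=.
  case: ifPn => [uw|//]; rewrite arcsine_avg_below_width//=.
  by rewrite /below_width /= y0.
apply: eq_integral => r _; rewrite /H !patchE mem_setE in_itv/=.
have -> : ((x, r, y) \in hypograph) = (0 < r < level_width (x, y))%R.
  case: (ltP 0%R r) => [r0|r0] /=.
    by rewrite lt_level_width//; apply/idP/idP; rewrite inE /hypograph /= y0.
  apply/negbTE/negP; rewrite inE /hypograph /= y0/= => /(lt_trans y0)/L_supp[_].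
  by rewrite ltNge r0.
by [].
Qed.

(** Layer-cake formula: [L x r] is the length of the heights in []0, L x r[]. *)
Lemma hypograph_measure (B : set T) : measurable B ->
  triple lam (hypograph_pos @^-1` B `&` hypograph) =
  \int[lam]_x \int[leb]_r (L x r * \1_B (smul r x))%:E.
Proof.
move=> mB; have mX : measurable (hypograph_pos @^-1` B `&` hypograph).
  apply: measurableI; last exact: measurable_hypograph.
  by rewrite -[X in measurable X]setTI; exact: measurable_hypograph_pos.
set X := _ `&` _ in mX *.
rewrite -[X in triple lam X]setIT -integral_indic// triple_integral; last 2 first.
- by apply/measurable_EFinP; exact: measurable_indic.
- by move=> q; rewrite lee_fin.
apply: eq_integral => x _; apply: eq_integral => r _.
transitivity (\int[leb]_y ((\1_B (smul r x))%:E * (\1_(`]0%R, L x r[%classic) y)%:E)).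
  apply: eq_integral => y _; rewrite -EFinM !indicE -natrM mulnb; congr (_%:R)%:E.
  congr nat_of_bool.
  have -> : (y \in `]0%R, L x r[%classic) = (0 < y < L x r)%R.
    by apply/idP/idP; rewrite inE /= in_itv.
  by apply/idP/andP; rewrite !inE /X /hypograph_pos /hypograph /=.
have mi : measurable_fun setT (\1_(`]0%R, L x r[%classic : set R) : R -> R).
  by apply: measurable_indic; exact: measurable_itv.
rewrite ge0_integralZl ?lee_fin//; last exact/measurable_EFinP.
rewrite integral_indic//.
rewrite setIT /= lebesgue_measure_itv/= lte_fin sube0 mulrC EFinM; congr (_ * _).
by case: ltP => // L0; congr EFin; apply/eqP; rewrite eq_le L0 L_ge0.
Qed.

(** The preimage [nu0] is the image of [below_width]. The identity [key], obtained fibrewise from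
    [arcsine_fiber], is used twice: indicators give that [A_1] maps [nu0] to [nu], and the truncated
    squared norm gives the integrability of [nu0]. *)
Lemma range_A1_radial_density (nu : {measure set T -> \bar R}) : levy nu ->
  (forall B, measurable B ->
    nu B = \int[lam]_x \int[leb]_r (L x r * \1_B (smul r x))%:E) ->
  range_A R d 1 nu.
Proof.
move=> [nu00 nufin] nuE.
have [nu' [nu'E nu'int]] := transport_measure (triple lam) measurable_hypograph
  measurable_hypograph_pos.
have [nu0 [nu0E nu0int]] := transport_measure (triple lam) measurable_below_width
  measurable_below_width_pos.
have nunu' B : measurable B -> nu B = nu' B.
  by move=> mB; rewrite nuE// nu'E// hypograph_measure.
have mnz := measurableC (@measurable_origin R d).
have key (g : T -> R) : measurable_fun setT g -> (forall y, 0 <= g y)%R ->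
    \int[nu0]_(x in ~` [set origin R d]) arcsine_avg g x = \int[nu]_x (g x)%:E.
  move=> mg g0; have avg0 x : 0 <= arcsine_avg g x by exact: arcsine_avg_ge0.
  have mavg := measurable_arcsine_avg mg g0.
  rewrite integral_mkcond nu0int; last 2 first.
  - by apply/(measurable_restrictT _ mnz)/measurable_funTS.
  - by apply: erestrict_ge0.
  rewrite [RHS](eq_measure_integral nu'); last by move=> A mA _; exact: nunu'.
  rewrite nu'int; last 2 first.
  - exact/measurable_EFinP.
  - by move=> y; rewrite lee_fin.
  transitivity (\int[triple lam]_(q in below_width) arcsine_avg g (below_width_pos q)).
    apply: eq_integral => q; rewrite inE => /below_width_pos_neq0/eqP q0.
    by rewrite patchE mem_set.
  rewrite [LHS]integral_mkcond triple_integral; last 2 first.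
  - apply/(measurable_restrictT _ measurable_below_width)/measurable_funTS.
    exact: (measurableT_comp mavg measurable_below_width_pos).
  - by apply: erestrict_ge0.
  rewrite [RHS]integral_mkcond [RHS]triple_integral; last 2 first.
  - apply/(measurable_restrictT _ measurable_hypograph)/measurable_funTS.
    by apply/measurable_EFinP; exact: (measurableT_comp mg measurable_hypograph_pos).
  - by apply: erestrict_ge0 => q _; rewrite lee_fin.
  by apply: eq_integral => x _; exact: arcsine_fiber.
have nu00' : nu0 [set origin R d] = 0.
  rewrite nu0E; last exact: measurable_origin.
  rewrite (_ : _ `&` _ = set0) ?measure0//; apply/seteqP; split => // q [/= q0].
  by move=> /below_width_pos_neq0; rewrite q0 eqxx.
have mmin n : measurable_fun setT (fun x : T => (Num.min 1 (enorm x ^+ n))%R).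
  by apply: measurable_minr => //; apply: measurable_funX; exact: measurable_enorm.
have min0 n (x : T) : (0 <= Num.min 1 (enorm x ^+ n))%R.
  by rewrite le_min ler01 exprn_ge0// enorm_ge0.
exists nu0; split; [split=> //|].
  rewrite (ge0_negligible_integral (@measurable_origin R d))//; last 2 first.
  - by apply/measurable_EFinP; exact: mmin.
  - by move=> x _; rewrite lee_fin.
  (* By [arcsine_avg_min_ge] and [key], the truncated first moment of [nu0] is at most [4 * pi]
     times the truncated second moment of [nu]. *)
  rewrite setTD; apply: (@le_lt_trans _ _ (\int[nu0]_(x in ~` [set origin R d])
      ((4 * pi)%:E * arcsine_avg (fun y : T => Num.min 1 (enorm y ^+ 2))%R x))).
    apply: ge0_le_integral => //.
    + by move=> x _; rewrite lee_fin.
    + by apply/measurable_EFinP; apply: measurable_funTS; exact: mmin.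
    + apply: measurable_funTS; apply: measurable_funeM.
      exact: measurable_arcsine_avg.
    + by move=> x /eqP x0; rewrite expr1; exact: arcsine_avg_min_ge.
  rewrite ge0_integralZl//; last 3 first.
  - by apply: measurable_funTS; exact: measurable_arcsine_avg.
  - by move=> x _; exact: arcsine_avg_ge0.
  - by rewrite lee_fin mulr_ge0// pi_ge0.
  by rewrite key//; apply: lte_mul_pinfty => //; rewrite lee_fin mulr_ge0// pi_ge0.
move=> B mB; rewrite A_op1E key//.
by rewrite integral_indic// setIT.
Qed.

End radial_density.

(** * The Jurek class *)

Section jurek.
Context (R : realType) (d : nat).
Local Notation T := (Rd R d).
Local Notation leb := (@lebesgue_measure R).
Local Open Scope ereal_scope.

Lemma lty_pmul2l (k : R) (x : \bar R) : (0 < k)%R -> 0 <= x ->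
  k%:E * x < +oo -> x < +oo.
Proof.
move=> k0; case: x => [r _ _|_|]; rewrite ?ltry//.
by rewrite gt0_muley ?lte_fin.
Qed.

(** Markov's inequality: beyond radius [e <= 1] the truncated square is at least [e ^+ 2]. *)
Lemma levy_tail_fin (nu : {measure set T -> \bar R}) (e : R) : levy nu ->
  (0 < e <= 1)%R -> nu (@enorm R d @^-1` `]e, +oo[%classic) < +oo.
Proof.
move=> [_ nufin] /andP[e0 e1].
set A := _ @^-1` _.
have mA : measurable A by apply: measurable_enorm_preimage; exact: measurable_itv.
have mmin : measurable_fun setT (fun x : T => (Num.min 1 (enorm x ^+ 2))%:E).
  apply/measurable_EFinP; apply: measurable_minr => //; apply: measurable_funX.
  exact: measurable_enorm.
have min0 (x : T) : 0 <= (Num.min 1 (enorm x ^+ 2))%:E.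
  by rewrite lee_fin le_min ler01 exprn_ge0// enorm_ge0.
apply: (@lty_pmul2l (e ^+ 2)) => //; first by rewrite exprn_gt0.
  apply: le_lt_trans nufin.
  apply: (@le_trans _ _ (\int[nu]_(x in A) (Num.min 1 (enorm x ^+ 2))%:E)); last first.
    exact: ge0_subset_integral.
  rewrite -integral_cst//; apply: ge0_le_integral => //.
  - by move=> x _; rewrite lee_fin sqr_ge0.
  - exact: measurable_funTS.
  - move=> x; rewrite /A /= in_itv/= andbT => ex.
    rewrite lee_fin le_min expr_le1 ?(ltW e0)// e1/=.
    by rewrite ler_sqr ?nnegrE ?enorm_ge0// ltW.
Qed.

(** Needed for Tonelli. On [A n] the fibre gives mass at least [e n] to []e n, +oo[], so
    [e n * lam (A n)] is bounded by a tail of [nu], which is finite. Positivity of the fibres makes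
    the [A n] cover the sphere. *)
Lemma polar_sigma_finite (nu lam : {measure set T -> \bar R}) nuxi : levy nu ->
  polar_decomposition nu lam nuxi -> sigma_finite setT lam.
Proof.
move=> lnu pol; have [lam0 [_ [mnuxi [nuxi0 _]]]] := pol.
have mS := @measurable_sphere R d.
pose e n : R := (n.+1%:R^-1)%R.
have e0 n : (0 < e n)%R by rewrite invr_gt0.
have e1 n : (e n <= 1)%R by rewrite invf_le1// ler1n.
pose I n : set R := `]e n, +oo[%classic.
have mI n : measurable (I n) by exact: measurable_itv.
have Ipos n : I n `<=` pos_reals R.
  by move=> r; rewrite /I /pos_reals /= !in_itv/= !andbT; exact: lt_trans.
pose A n := sphere R d `&` [set x | (e n)%:E <= nuxi x (I n)].
have mA n : measurable (A n).
  by apply: emeasurable_fun_c_infty => //; exact: mnuxi.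
exists (fun n => A n `|` ~` sphere R d) => [|n]; last first.
  split; first by apply: measurableU => //; exact: measurableC.
  rewrite (@le_lt_trans _ _ (lam (A n) + lam (~` sphere R d)))//.
    by apply: measureU2 => //; exact: measurableC.
  rewrite lam0 adde0.
  apply: (@lty_pmul2l (e n)) => //.
    apply: (@le_lt_trans _ _ (nu (@enorm R d @^-1` I n))); last first.
      by apply: levy_tail_fin => //; rewrite e0 e1.
    rewrite (polar_radial pol)// -integral_cst//.
    apply: (@le_trans _ _ (\int[lam]_(x in A n) nuxi x (I n))).
      apply: ge0_le_integral => //.
      - by move=> x _; rewrite lee_fin ltW.
      - by apply: measurable_funS (mnuxi _ (mI n)) => // x [].
      - by move=> x [].
    apply: ge0_subset_integral => //; first exact: mnuxi.
    by move=> x [].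
apply/seteqP; split => // x _; apply: contrapT => xnA.
have Sx : sphere R d x by apply: contrapT => Sx; apply: xnA; exists 0%N => //; right.
have lex n : nuxi x (I n) < (e n)%:E.
  by rewrite ltNge; apply/negP => h; apply: xnA; exists n => //; left.
(* A direction outside every [A n] has fibre mass below [e k] on [I k], which contains [I n] for
   [k >= n]; letting [k] grow gives 0. *)
have I0 n : nuxi x (I n) = 0.
  apply/eqP; rewrite eq_le measure_ge0 andbT; apply/lee_addgt0Pr => r r0.
  rewrite add0e.
  have [m rm] : exists m, (e m <= r)%R.
    exists (Num.truncn r^-1).
    rewrite /e -[leRHS]invrK lef_pV2 ?posrE ?invr_gt0//.
    exact: ltW (truncnS_gt _).
  pose k := maxn n m.
  apply: (@le_trans _ _ (nuxi x (I k))).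
    apply: le_measure; rewrite ?inE// => s; rewrite /I /= !in_itv/= !andbT.
    by apply: le_lt_trans; rewrite /e lef_pV2 ?posrE// ler_nat ltnS leq_maxl.
  apply: (le_trans (ltW (lex k))); rewrite lee_fin; apply: le_trans rm.
  by rewrite /e lef_pV2 ?posrE// ler_nat ltnS leq_maxr.
have := nuxi0 x Sx; rewrite (_ : pos_reals R = \bigcup_n I n); last first.
  apply/seteqP; split => [r|r [n _ /Ipos//]].
  rewrite /pos_reals /= in_itv/= andbT => r0; exists (Num.truncn r^-1) => //.
  rewrite /I /= in_itv/= andbT /e -[ltRHS]invrK ltf_pV2 ?posrE ?invr_gt0//.
  exact: truncnS_gt.
have : nuxi x (\bigcup_n I n) = 0.
  apply/negligibleP; first by apply: bigcupT_measurable.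
  apply: negligible_bigcup => n; apply/negligibleP; [exact: mI|exact: I0].
by move=> ->; rewrite ltxx.
Qed.


(** The data are brought into the form required by [range_A1_radial_density]: [lam] is restricted to
    the sphere and [l] is extended by zero. *)
Lemma jurek_subset_range_A1 : jurek_class R d `<=` range_A R d 1.
Proof.
move=> f [nu [lnu [fE [lam [nuxi [l [pol [ml [l0 [ldec [lrc lE]]]]]]]]]]].
suff [nu0 [lnu0 nu0E]] : range_A R d 1 nu.
  by exists nu0; split => // B mB; rewrite fE// nu0E.
have mS := @measurable_sphere R d; have mpos := @measurable_pos_reals R.
have [_ [_ [mnuxi [_ nuE]]]] := pol.
have lamS_sfin : sigma_finite setT (mrestr lam mS).
  have [F FT Ffin] := polar_sigma_finite lnu pol; exists F => // n.
  have [mF Foo] := Ffin n; split => //; apply: le_lt_trans Foo.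
  by rewrite /mrestr; apply: le_measure; rewrite ?inE//; exact: measurableI.
pose lamS : {sigma_finite_measure set T -> \bar R} :=
  HB.pack (mrestr lam mS) (Measure_isSigmaFinite.Build _ _ _ (mrestr lam mS) lamS_sfin).
pose I : set R := `]1%R, +oo[%classic.
have mI : measurable I by exact: measurable_itv.
have Ipos : I `<=` pos_reals R.
  by move=> r; rewrite /I /pos_reals /= !in_itv/= !andbT; exact: lt_trans.
(* Fibres with infinite mass on ]1, +oo[ form a null set and are discarded, so
   that the remaining densities vanish at infinity. *)
pose G := sphere R d `&` [set x | nuxi x I < +oo].
have mG : measurable G by apply: emeasurable_fun_infty_o => //; exact: mnuxi.
pose N := sphere R d `\` G; have mN : measurable N by exact: measurableD.
have lamN : lam N = 0.
  apply/eqP; rewrite eq_le measure_ge0 andbT leNgt; apply/negP => N0.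
  (* Fibres over [N] have infinite mass on [I], so [+oo * lam N] is at most the finite mass that
     [nu] gives to [|x| > 1]. *)
  have : +oo * lam N < +oo; last by rewrite gt0_mulye.
  have e1 : (0 < (1 : R) <= 1)%R by rewrite ltr01 lexx.
  apply: le_lt_trans (levy_tail_fin lnu e1).
  rewrite (polar_radial pol)// -integral_cst//.
  apply: (@le_trans _ _ (\int[lam]_(x in N) nuxi x I)).
    apply: ge0_le_integral => //.
    - by move=> x _; exact: leey.
    - by apply: measurable_funS (mnuxi _ mI) => // x [].
    - by move=> x [Sx nGx]; rewrite leNgt; apply/negP => xoo; apply: nGx.
  apply: ge0_subset_integral => //; first exact: mnuxi.
  by move=> x [].
(* The set [A] is a parameter because the extension is used over [G], as the density, and over the
   whole sphere, to recover [nu]. *)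
pose Lr (A : set T) (x : T) (r : R) : R :=
  ((fun p : T * R => l p.1 p.2) \_ (A `*` pos_reals R)) (x, r).
have Lr_in A x r : A x -> (0 < r)%R -> Lr A x r = l x r.
  by move=> Ax r0; rewrite /Lr patchE mem_set//; split => //=; rewrite /pos_reals /= in_itv/= r0.
have Lr_out A x r : ~ (A x /\ (0 < r)%R) -> Lr A x r = 0%R.
  move=> h; rewrite /Lr patchE memNset// => -[/= Ax].
  by rewrite /pos_reals /= in_itv/= andbT => r0; apply: h.
have mLr A : measurable A -> A `<=` sphere R d ->
    measurable_fun setT (fun p : T * R => Lr A p.1 p.2).
  move=> mA AS; rewrite (_ : (fun p => _) =
      (fun p : T * R => l p.1 p.2) \_ (A `*` pos_reals R)); last first.
    by apply/funext => -[x r].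
  apply/(measurable_restrictT _ (measurableX mA mpos)).
  by apply: measurable_funS ml; [exact: measurableX|exact: setSX].
have Lr_ge0 A x r : A `<=` sphere R d -> (0 <= Lr A x r)%R.
  move=> AS; have [[Ax r0]|h] := pselect (A x /\ (0 < r)%R); last by rewrite Lr_out.
  by rewrite Lr_in// l0//; exact: AS.
have GS : G `<=` sphere R d by move=> x [].
pose phi A B x := \int[leb]_r (Lr A x r * \1_B (smul r x))%:E.
have mphi A B : measurable A -> A `<=` sphere R d -> measurable B ->
    measurable_fun setT (phi A B).
  move=> mA AS mB.
  apply: (@measurable_fun_fubini_tonelli_F _ _ _ _ _ leb
    (fun p : T * R => (Lr A p.1 p.2 * \1_B (smul p.2 p.1))%:E)).
    apply/measurable_EFinP; apply: measurable_funM; first exact: mLr.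
    apply: (measurableT_comp (measurable_indic mB)).
    apply: (measurableT_comp (@measurable_smul R d) (g := fun p : T * R => (p.2, p.1))).
    exact: measurable_fun_pair.
  by move=> p; rewrite lee_fin mulr_ge0// Lr_ge0.
have phi0 A B x : A `<=` sphere R d -> 0 <= phi A B x.
  by move=> AS; apply: integral_ge0 => r _; rewrite lee_fin mulr_ge0// Lr_ge0.
apply: (@range_A1_radial_density _ _ lamS (Lr G)) => //.
- exact: mLr.
- by move=> x r; exact: Lr_ge0.
- move=> x r; have [[Gx r0]|h] := pselect (G x /\ (0 < r)%R).
    by move=> _; split => //; exact: GS.
  by rewrite Lr_out// ltxx.
- move=> x r s r0 rs; have s0 := lt_le_trans r0 rs.
  have [Gx|nGx] := pselect (G x); last by rewrite !Lr_out// => -[].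
  by rewrite !Lr_in//; apply: (ldec x (GS _ Gx)); rewrite // in_itv/= ?r0 ?s0.
- move=> x r y r0; have [Gx|nGx] := pselect (G x); last first.
    rewrite Lr_out; last by case.
    by move=> y0; exists (r + 1)%R; rewrite ?ltrDl// Lr_out// => -[].
  rewrite Lr_in// => yr.
  have := lrc x r (GS _ Gx) r0 => /cvgrPdist_lt /(_ (l x r - y)%R).
  rewrite subr_gt0 => /(_ yr) near_r.
  (* Right continuity with tolerance [l x r - y] keeps the density above [y] just to the right of
     [r]. *)
  have [s [rs sy]] : exists s, (r < s)%R /\ (`|l x r - l x s| < l x r - y)%R.
    near (r^'+) => s; exists s; split; first by near: s; exact: nbhs_right_gt.
    by near: s.
  exists s => //; rewrite Lr_in//; last exact: lt_trans rs.
  by move: sy; rewrite ltr_norml => /andP[_]; lra.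
- move=> x y y0; have [Gx|nGx] := pselect (G x); last first.
    by exists 1%R => //; rewrite Lr_out ?ltW// => -[].
  (* A density staying above [y > 0] would give []1, +oo[] infinite mass, which membership in [G]
     excludes. *)
  apply: contrapT => h; have [Sx Ioo] := Gx; move: Ioo; rewrite /= ltNge => /negP; apply.
  rewrite lE// (setIidl Ipos).
  apply: (@le_trans _ _ (\int[leb]_(r in I) y%:E)).
    rewrite integral_cst//= /I lebesgue_measure_itv/= ltry.
    by rewrite gt0_muley ?lte_fin.
  apply: ge0_le_integral => //.
  + by move=> r _; rewrite lee_fin ltW.
  + apply/measurable_EFinP; apply: (@measurable_funS _ _ _ _ (pos_reals R)) => //.
    apply: (@measurable_comp _ _ _ _ _ _ _ (fun p : T * R => l p.1 p.2) _
      (fun r => (x, r)) _ _ ml) => //.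
    * exact: measurableX.
    * by move=> _ [r rp <-].
    * by apply: measurable_funTS; exact: pair1_measurable.
  + move=> r; rewrite /I /= in_itv/= andbT => r1; rewrite lee_fin leNgt; apply/negP => ry.
    have r0 : (0 < r)%R by exact: lt_trans r1.
    by apply: h; exists r => //; rewrite Lr_in// ltW.
move=> B mB; rewrite [RHS](ge0_integral_mrestr lam mS (mphi G B mG GS mB)); last first.
  by move=> x; exact: phi0.
(* The integral over the full sphere is [nu B]. Discarding the null set [N] on both sides leaves
   directions in [G], where the two extensions agree. *)
transitivity (\int[lam]_(x in sphere R d) phi (sphere R d) B x).
  rewrite nuE//; apply: eq_integral => x; rewrite inE => Sx.
  pose Bx := (fun r : R => smul r x) @^-1` B.
  have mBx : measurable Bx.
    rewrite -[X in measurable X]setTI.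
    apply: (measurableT_comp (@measurable_smul R d) (g := fun r : R => (r, x))) => //.
  transitivity (\int[nuxi x]_(r in pos_reals R) (\1_Bx r)%:E) => //.
  rewrite integral_indic// lE//; last exact: measurableI.
  rewrite integral_mkcond; apply: eq_integral => r _.
  rewrite patchE indicE -setIA setIid in_setI mem_pos_reals.
  rewrite (_ : (r \in Bx) = (smul r x \in B)); last by apply/idP/idP; rewrite !inE.
  have [r0|r0] := ltP 0%R r; last first.
    by rewrite andbF Lr_out ?mul0r// => -[_]; rewrite ltNge r0.
  by rewrite andbT Lr_in//; case: ifPn => _; rewrite ?mulr1 ?mulr0.
rewrite [LHS](ge0_negligible_integral mN)//; last 2 first.
- by apply: measurable_funTS; exact: mphi.
- by move=> x _; exact: phi0.
rewrite [RHS](ge0_negligible_integral mN)//; last 2 first.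
- by apply: measurable_funTS; exact: mphi.
- by move=> x _; exact: phi0.
apply: eq_integral => x; rewrite inE => -[Sx xN]; apply: eq_integral => r _.
have Gx : G x by apply: contrapT => nGx; apply: xN.
have [r0|r0] := ltP 0%R r; first by rewrite !Lr_in.
by rewrite !Lr_out// => -[_]; rewrite ltNge r0.
Unshelve. all: by end_near. Qed.

End jurek.

Theorem theorem2p12 (R : realType) (d : nat) : (0 < d)%N ->
  jurek_class R d `<` range_A R d 1 /\ range_A R d 1 = range_A R d 2.
Proof.
move=> d0; split; last exact: range_A1_A2.
split; first exact: jurek_subset_range_A1.
(* Positive dimension supplies a unit vector, whose Dirac mass has an image under [A_1] outside the
   Jurek class. *)
pose e : Rd R d := (delta_mx ord0 (Ordinal d0) : 'rV[R]_d).
have e1 : enorm e = 1 by exact: enorm_delta.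
by move=> /(_ _ (range_A1_dirac e1)); exact: A_op1_dirac_not_jurek.
Qed.
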